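(* Let $\mathcal A(\widetilde B)$ be a skew-symmetric cluster algebra of geometric type, where $\widetilde B$ is an $n\times r$ integer matrix with skew-symmetric top $r\times r$ submatrix $B$. Then the cluster complex of $\mathcal A(\widetilde B)$ only depends on $B$. That is, if $\widetilde B$ and $\widetilde B'$ are integer matrices of sizes $n\times r$ and $n'\times r$ ($n,n'\ge r$) with the same skew-symmetric top $r\times r$ submatrix $B$, then the cluster complexes of $\mathcal A(\widetilde B)$ and $\mathcal A(\widetilde B')$ are isomorphic simplicial complexes.
   Context: Cluster algebras of geometric type. Let $\widetilde B=(b_{kj})$ be an $n\times r$ integer matrix whose top $r\times r$ submatrix $B$ is skew-symmetric. Write $[z]_+=\max(0,z)$. A seed is a pair $(\widetilde B,(u_1,\dots,u_n))$ where $\widetilde B$ is such a matrix and $(u_1,\dots,u_n)$ is a free generating set of the field $\mathbb{Q}(x_1,\dots,x_n)$. For $i\in\{1,\dots,r\}$, the mutation of this seed at $i$ is $(\widetilde B',(u'_1,\dots,u'_n))$ where $b'_{kj}=-b_{kj}$ if $k=i$ or $j=i$, and $b'_{kj}=b_{kj}+\frac{b_{ki}|b_{ij}|+|b_{ki}|b_{ij}}{2}$ otherwise; $u'_j=u_j$ for $j\ne i$; and $u_iu_i'=\prod_{j=1}^n u_j^{[b_{ji}]_+}+\prod_{j=1}^n u_j^{[-b_{ji}]_+}$. The initial seed is $(\widetilde B,(x_1,\dots,x_n))$, and the seeds of $\mathcal A(\widetilde B)$ are those obtained from it by iterated mutations at $1,\dots,r$ (so $u_j=x_j$ for $j>r$).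 The clusters are the sets $\{u_1,\dots,u_r\}$ coming from these seeds, and the cluster variables are the elements of clusters. $\mathcal A(\widetilde B)$ is the subalgebra of $\mathbb{Q}(x_1,\dots,x_n)$ generated over $\mathbb{Z}[x_{r+1}^{\pm1},\dots,x_n^{\pm1}]$ by all cluster variables. The cluster complex of a cluster algebra is the simplicial complex whose set of vertices is the set of cluster variables and whose simplices are the subsets of clusters. *)

(* Defs.v *)
From HB Require Import structures.
From mathcomp Require Import all_boot all_order all_algebra.
From mathcomp Require Import finmap mpoly.

Set Implicit Arguments.
Unset Strict Implicit.
Unset Printing Implicit Defensive.

Import Order.TTheory GRing.Theory Num.Theory.
Local Open Scope ring_scope.

(* The field Q(x_1, ..., x_n), and its generators x_i. *)
Notation ratfun n := {fraction {mpoly rat[n]}}.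

Definition ratvar (n : nat) (i : 'I_n) : ratfun n := tofrac 'X_i.

(* The value p(u_1, ..., u_n) of a rational polynomial in Q(x_1, ..., x_n). *)
Definition eval_at (n : nat) (u : 'I_n -> ratfun n) : {mpoly rat[n]} -> ratfun n :=
  mmap (@tofrac {mpoly rat[n]} \o @mpolyC n rat) u.

(* The u_i are algebraically independent over Q, and Q(u_1, ..., u_n) is the
   whole field. *)
Definition free_generating (n : nat) (u : 'I_n -> ratfun n) : Prop :=
  (forall p : {mpoly rat[n]}, eval_at u p = 0 -> p = 0) /\
  (forall f : ratfun n, exists p q : {mpoly rat[n]},
     eval_at u q != 0 /\ f = eval_at u p / eval_at u q).

Definition skew_symmetric (r : nat) (B : 'M[int]_r) : Prop := B^T = - B.

Definition pospart (z : int) : nat := absz (Num.max 0 z).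

(* An n x r matrix with n >= r is written with n = r + m: its top r x r
   submatrix is [usubmx], and an index i <= r becomes the row [lshift m i]. *)
Record preseed (r m : nat) := Preseed {
  xmat : 'M[int]_(r + m, r);
  xvar : 'I_(r + m) -> ratfun (r + m)
}.

Definition is_seed (r m : nat) (S : preseed r m) : Prop :=
  skew_symmetric (usubmx (xmat S)) /\ free_generating (xvar S).

(* The division by 2 is exact; see [dvdz2_mutation]. *)
Definition mutate_mat (r m : nat) (i : 'I_r) (B : 'M[int]_(r + m, r)) :
    'M[int]_(r + m, r) :=
  \matrix_(k, j)
    if (k == lshift m i) || (j == i) then - B k j
    else B k j + ((B k i * `|B (lshift m i) j| +
                   `|B k i| * B (lshift m i) j) %/ 2)%Z.

Definition exchange_rhs (n r : nat) (A : comPzRingType) (i : 'I_r)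
    (B : 'M[int]_(n, r)) (u : 'I_n -> A) : A :=
  \prod_j u j ^+ pospart (B j i) + \prod_j u j ^+ pospart (- B j i).

(* For a seed, u_i is nonzero, so this u'_i is the solution of the exchange
   relation; see [exchange_relation]. *)
Definition mutate_var (r m : nat) (i : 'I_r) (B : 'M[int]_(r + m, r))
    (u : 'I_(r + m) -> ratfun (r + m)) (j : 'I_(r + m)) : ratfun (r + m) :=
  if j == lshift m i then exchange_rhs i B u / u j else u j.

Definition mutate (r m : nat) (i : 'I_r) (S : preseed r m) : preseed r m :=
  Preseed (mutate_mat i (xmat S)) (mutate_var i (xmat S) (xvar S)).

Definition initial_seed (r m : nat) (Bt : 'M[int]_(r + m, r)) : preseed r m :=
  Preseed Bt (@ratvar (r + m)).

Inductive seed_of (r m : nat) (Bt : 'M[int]_(r + m, r)) : preseed r m -> Prop :=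
| seed_of_initial : seed_of Bt (initial_seed Bt)
| seed_of_mutate (i : 'I_r) (S : preseed r m) :
    seed_of Bt S -> seed_of Bt (mutate i S).

Definition cluster (r m : nat) (S : preseed r m) : {fset ratfun (r + m)} :=
  [fset xvar S (lshift m i) | i : 'I_r]%fset.

Definition is_cluster_var (r m : nat) (Bt : 'M[int]_(r + m, r))
    (x : ratfun (r + m)) : Prop :=
  exists S : preseed r m, seed_of Bt S /\ x \in cluster S.

Record simplicial_complex (V : choiceType) := SimplicialComplex {
  vertex : V -> Prop;
  simplex : {fset V} -> Prop;
  simplex_vertex : forall (A : {fset V}) (x : V), simplex A -> x \in A -> vertex x;
  vertex_simplex : forall x : V, vertex x -> simplex [fset x]%fset;
  simplex_sub : forall A C : {fset V}, (A `<=` C)%fset -> simplex C -> simplex A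
}.

(* Mutually inverse bijections between the vertex sets, both preserving
   simplices; only the values of f and g on vertices matter. *)
Definition sc_isomorphic (V W : choiceType) (X : simplicial_complex V)
    (Y : simplicial_complex W) : Prop :=
  exists (f : V -> W) (g : W -> V),
    [/\ forall x, vertex X x -> vertex Y (f x) /\ g (f x) = x,
        forall y, vertex Y y -> vertex X (g y) /\ f (g y) = y,
        forall A : {fset V}, simplex X A -> simplex Y [fset f x | x in A]%fset
      & forall C : {fset W}, simplex Y C -> simplex X [fset g y | y in C]%fset].

Definition cluster_simplex (r m : nat) (Bt : 'M[int]_(r + m, r))
    (A : {fset ratfun (r + m)}) : Prop :=
  exists S : preseed r m, seed_of Bt S /\ (A `<=` cluster S)%fset.

Lemma cluster_simplex_vertex (r m : nat) (Bt : 'M[int]_(r + m, r)) A x :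
  cluster_simplex Bt A -> x \in A -> is_cluster_var Bt x.
Proof. by move=> [S [sS /fsubsetP sA]] /sA xS; exists S. Qed.

Lemma cluster_vertex_simplex (r m : nat) (Bt : 'M[int]_(r + m, r)) x :
  is_cluster_var Bt x -> cluster_simplex Bt [fset x]%fset.
Proof. by move=> [S [sS xS]]; exists S; rewrite fsub1set. Qed.

Lemma cluster_simplex_sub (r m : nat) (Bt : 'M[int]_(r + m, r))
    (A C : {fset ratfun (r + m)}) :
  (A `<=` C)%fset -> cluster_simplex Bt C -> cluster_simplex Bt A.
Proof. by move=> AC [S [sS CS]]; exists S; split=> //; apply: fsubset_trans CS. Qed.

Definition cluster_complex (r m : nat) (Bt : 'M[int]_(r + m, r)) :
    simplicial_complex (ratfun (r + m)) :=
  SimplicialComplex (@cluster_simplex_vertex r m Bt)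
    (@cluster_vertex_simplex r m Bt) (@cluster_simplex_sub r m Bt).

(* The rest of the file shows that [preseed]s reached from a skew-symmetric
   exchange matrix are genuine seeds; see [seed_of_is_seed]. *)

Section SeedTheory.

Variables (n : nat).
Implicit Types (u : 'I_n -> ratfun n) (p q : {mpoly rat[n]}).

Lemma eval_atD u p q : eval_at u (p + q) = eval_at u p + eval_at u q.
Proof. exact: mmapD. Qed.

Lemma eval_atM u p q : eval_at u (p * q) = eval_at u p * eval_at u q.
Proof. exact: rmorphM. Qed.

Lemma eval_atXn u p k : eval_at u (p ^+ k) = eval_at u p ^+ k.
Proof. exact: rmorphXn. Qed.

Lemma eval_atC u c : eval_at u c%:MP = tofrac c%:MP.
Proof. exact: mmapC. Qed.

Lemma eval_atX u i : eval_at u 'X_i = u i.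
Proof. by rewrite /eval_at mmapX mmap1U. Qed.

Lemma eval_at_ratvar p : eval_at (@ratvar n) p = tofrac p.
Proof.
elim/mpolyind: p => [|c mm p _ _ IH]; first by rewrite /eval_at mmap0 rmorph0.
rewrite eval_atD IH rmorphD /=; congr (_ + _).
rewrite -mul_mpolyC eval_atM eval_atC rmorphM /=; congr (_ * _).
rewrite /eval_at mmapX mpolyXE_id rmorph_prod /mmap1 /=.
by apply: eq_bigr => i _; rewrite rmorphXn.
Qed.

Lemma free_generating_ratvar : free_generating (@ratvar n).
Proof.
split=> [p|f]; first by rewrite eval_at_ratvar => /eqP; rewrite tofrac_eq0 => /eqP.
elim/quotW: f => f; have d0 := denom_ratioP f.
exists \n_f, \d_f; rewrite !eval_at_ratvar tofrac_eq0; split=> //.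
apply: (canRL (mulfK _)); first by rewrite tofrac_eq0.
rewrite -[X in _ * X]/(tofrac _); unlock tofrac; rewrite !piE.
apply/eqmodP.
rewrite /= FracField.equivfE /FracField.mulf !numden_Ratio ?mulf_neq0 ?oner_eq0 //.
by rewrite !mulr1 mulrC.
Qed.

Lemma free_generating_neq0 u i : free_generating u -> u i != 0.
Proof.
move=> [fu _]; apply/eqP => ui0.
have := fu 'X_i; rewrite eval_atX => /(_ ui0) /(congr1 (meval (fun=> 1))).
by rewrite mevalXU meval0 => /eqP; rewrite oner_eq0.
Qed.

End SeedTheory.

Lemma div_clear_denoms (F : fieldType) (p q a b w : F) (k l : nat) :
  w != 0 -> p = a / w ^+ k -> q = b / w ^+ l -> q != 0 ->
  b * w ^+ k != 0 /\ p / q = (a * w ^+ l) / (b * w ^+ k).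
Proof.
move=> w0 -> -> q0; have b0 : b != 0.
  by apply: contraNneq q0 => ->; rewrite mul0r.
split; first by rewrite mulf_neq0 ?expf_neq0.
by rewrite invf_div mulf_div [w ^+ k * b]mulrC.
Qed.

Section Mutation.

Variables (r m : nat) (i : 'I_r) (B : 'M[int]_(r + m, r)).
Variable u : 'I_(r + m) -> ratfun (r + m).
Hypothesis Bii : B (lshift m i) i = 0.
Hypothesis fu : free_generating u.

Local Notation u' := (mutate_var i B u).
Local Notation ei := (lshift m i).
Local Notation P := (exchange_rhs i B (fun j => 'X_j : {mpoly rat[r + m]})).

Lemma eval_exchange (v : 'I_(r + m) -> ratfun (r + m)) :
  eval_at v P = exchange_rhs i B v.
Proof.
rewrite /exchange_rhs eval_atD /eval_at !rmorph_prod /=.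
by congr (_ + _); apply: eq_bigr => j _; rewrite rmorphXn /= -/(eval_at v _) eval_atX.
Qed.

Lemma exchange_neq0 : P != 0.
Proof.
apply/eqP => /(congr1 (meval (fun=> 1))).
rewrite meval0 mevalD !rmorph_prod /= !big1 // => j _.
  by rewrite rmorphXn /= mevalXU expr1n.
by rewrite rmorphXn /= mevalXU expr1n.
Qed.

Lemma exchange_mutate : exchange_rhs i B u' = exchange_rhs i B u.
Proof.
congr (_ + _); apply: eq_bigr => j _; rewrite /mutate_var;
  by case: eqP => // ->; rewrite Bii ?oppr0.
Qed.

Lemma exchange_relation : u ei * u' ei = exchange_rhs i B u.
Proof. by rewrite /mutate_var eqxx mulrC divfK // free_generating_neq0. Qed.

Lemma exchange_eval_neq0 : exchange_rhs i B u != 0.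
Proof.
rewrite -eval_exchange; apply/eqP => /(proj1 fu) /eqP.
by rewrite (negPf exchange_neq0).
Qed.

Lemma mutate_var_neq0 : u' ei != 0.
Proof.
have := exchange_eval_neq0; rewrite -exchange_relation mulf_eq0 negb_or.
by case/andP.
Qed.

(* A polynomial in the u'_j is a Laurent polynomial N / u_i^d in the u_j, and
   evaluating N back at the u'_j recovers p up to the same denominators. *)
Lemma laurent_mutate (p : {mpoly rat[r + m]}) :
  exists d N, eval_at u N = eval_at u' p * u ei ^+ d /\
    eval_at u' N * u ei ^+ d = exchange_rhs i B u ^+ d * eval_at u p.
Proof.
pose Q p := exists d N, eval_at u N = eval_at u' p * u ei ^+ d /\
    eval_at u' N * u ei ^+ d = exchange_rhs i B u ^+ d * eval_at u p.
have relX : eval_at u' 'X_ei * u ei = exchange_rhs i B u.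
  by rewrite eval_atX mulrC exchange_relation.
have QM p1 p2 : Q p1 -> Q p2 -> Q (p1 * p2).
  move=> [d1 [N1 [e1 f1]]] [d2 [N2 [e2 f2]]]; exists (d1 + d2)%N, (N1 * N2).
  rewrite !eval_atM e1 e2 !exprD; split; first by rewrite mulrACA.
  by rewrite mulrACA f1 f2 mulrACA.
have QD p1 p2 : Q p1 -> Q p2 -> Q (p1 + p2).
  move=> [d1 [N1 [e1 f1]]] [d2 [N2 [e2 f2]]]; exists (d1 + d2)%N.
  exists (N1 * 'X_ei ^+ d2 + N2 * 'X_ei ^+ d1).
  rewrite !eval_atD !eval_atM !eval_atXn !eval_atX e1 e2 !exprD.
  split; first by rewrite mulrDl !mulrA [X in _ + X]mulrAC.
  have rX k : exchange_rhs i B u ^+ k = u' ei ^+ k * u ei ^+ k.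
    by rewrite -exprMn -relX eval_atX.
  rewrite mulrDl mulrACA f1 -rX [u ei ^+ d1 * _]mulrC mulrACA f2 -rX mulrDr.
  by congr (_ + _); [rewrite mulrAC | rewrite mulrC mulrA].
have QC c : Q c%:MP.
  by exists 0%N, c%:MP; rewrite !eval_atC !expr0 !mulr1 mul1r.
have QX j : Q 'X_j.
  case: (eqVneq j ei) => [->|nj].
    exists 1%N, P; rewrite !eval_exchange exchange_mutate !expr1 relX.
    by split=> //; rewrite eval_atX.
  exists 0%N, 'X_j; rewrite !eval_atX !expr0 !mulr1 mul1r /mutate_var.
  by rewrite (negPf nj).
rewrite -/(Q p); elim/mpolyind: p => [|c mm p _ _ IH]; first by rewrite -mpolyC0.
apply: QD => //; rewrite -mul_mpolyC; apply: (QM _ _) => //.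
have Q1 : Q 1 by rewrite -mpolyC1.
rewrite mpolyXE_id; apply: (big_ind Q Q1 QM) => j _.
by elim: (mm j) => [|k IHk]; [rewrite expr0 | rewrite exprS; apply: (QM _ _)].
Qed.

Lemma free_generating_mutate : free_generating u'.
Proof.
have ui0 := free_generating_neq0 ei fu; have P0 := exchange_eval_neq0.
have u'i0 := mutate_var_neq0.
split=> [p p0|f].
  have [d [N [eN fN]]] := laurent_mutate p.
  move: eN; rewrite p0 mul0r => /(proj1 fu) N0.
  move/eqP: fN; rewrite N0 {1}/eval_at rmorph0 mul0r eq_sym mulf_eq0.
  by rewrite expf_eq0 (negPf P0) andbF /= => /eqP /(proj1 fu).
have [p [q [q0 ->]]] := proj2 fu f.
have E p1 : exists d N, eval_at u p1 = eval_at u' N / u' ei ^+ d.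
  have [d [N [_ fN]]] := laurent_mutate p1; exists d, N.
  apply: (canRL (mulfK _)); first by rewrite expf_neq0.
  apply: (mulIf (expf_neq0 d ui0)).
  by rewrite fN -mulrA -exprMn [u' ei * _]mulrC exchange_relation mulrC.
have [d1 [N1 e1]] := E p; have [d2 [N2 e2]] := E q.
exists (N1 * 'X_ei ^+ d2), (N2 * 'X_ei ^+ d1).
rewrite !eval_atM !eval_atXn !eval_atX.
exact: div_clear_denoms e1 e2 q0.
Qed.

End Mutation.

Lemma dvdz2_mutation (b c : int) : (2 %| b * `|c| + `|b| * c)%Z.
Proof.
case: (ger0P b) => _; case: (ger0P c) => _.
- by apply/dvdzP; exists (b * c); rewrite -[RHS]/(b * c * (1 + 1)) mulrDr mulr1.
- by rewrite mulrN addNr dvdz0.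
- by rewrite mulNr addrN dvdz0.
- by apply/dvdzP; exists (- (b * c)); rewrite -[RHS]/(- (b * c) * (1 + 1)) mulrDr mulr1 mulrN mulNr.
Qed.

Lemma skew_symmetric_mutate (r m : nat) (i : 'I_r) (B : 'M[int]_(r + m, r)) :
  skew_symmetric (usubmx B) -> skew_symmetric (usubmx (mutate_mat i B)).
Proof.
move=> sB.
have sE a b : B (lshift m b) a = - B (lshift m a) b.
  by have /matrixP/(_ a b) := sB; rewrite !mxE.
apply/matrixP => a b; rewrite !mxE !(inj_eq (@lshift_inj _ _)).
rewrite orbC; case: ifP => _; first by rewrite sE.
rewrite (sE b a) (sE i a) (sE b i) !normrN opprD; congr (_ + _); first by rewrite opprK.
have /dvdzP[q e] := dvdz2_mutation (B (lshift m b) i) (B (lshift m i) a).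
have -> : - B (lshift m i) a * `|B (lshift m b) i| +
    `|B (lshift m i) a| * - B (lshift m b) i = - q * 2.
  by rewrite !mulNr -e mulrN -opprD addrC mulrC [X in - (_ + X)]mulrC.
by rewrite e !mulzK // opprK.
Qed.

Lemma seed_of_is_seed (r m : nat) (Bt : 'M[int]_(r + m, r)) (S : preseed r m) :
  skew_symmetric (usubmx Bt) -> seed_of Bt S -> is_seed S.
Proof.
move=> sB; elim=> [|i {}S _ [sS fS]].
  by split=> //; apply: free_generating_ratvar.
split; first exact: skew_symmetric_mutate.
apply: free_generating_mutate => //.
have /matrixP/(_ i i) := sS; rewrite !mxE => /eqP.
by rewrite -addr_eq0 -mulr2n mulrn_eq0 /= => /eqP.
Qed.

(* Main.v *)
Require Import Defs.
From mathcomp Require Import all_boot all_order all_algebra.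
From mathcomp Require Import finmap mpoly.
From mathcomp Require Import ring zify.
From Stdlib Require Import FunctionalExtensionality ClassicalEpsilon.

(** Write x_(i,w) for the i-th variable of the seed reached along a word w of
    mutations.  Matching x_(i,w) in one algebra with x_(i,w) in the other is an
    isomorphism of cluster complexes as soon as the coincidences
    x_(i,w) = x_(j,w') hold in one algebra exactly when they hold in the other.
    After all frozen variables are set to 1 the exchange relations involve only
    the principal part B, so everything rests on one claim: a coincidence that
    holds with the frozen variables set to 1 already holds before
    ([path_eq_frozen_one]).

    Take the seed containing x_(j,w') as initial.  By the Laurent phenomenon the
    quotient g = x_(i,w) / x_(j,w') is a Laurent polynomial in that seed.  Along
    a curve in which one mutable variable tends to 0 or to infinity, g grows
    with an exponent given by the tropical exchange relations, because no
    cancellation can occur between subtraction-free expressions; this exponent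
    does not depend on the values of the other variables.  Where the frozen
    variables are 1 the function g is constant, so all these exponents vanish
    and g does not depend on the mutable variables ([ratio_indep_mutable]).  By
    symmetry 1 / g is a Laurent polynomial in the frozen variables as well, so g
    is a monomial in them.  A cluster variable is neither divisible by a frozen
    variable nor has it in its denominator, again by the tropical exchange
    relation ([trop_path_frozen]), so that monomial is constant, and its value
    is 1 ([ratio_eq1]).

    A subtraction-free rational function is determined by its values at points
    with positive rational coordinates ([evaluates_inj]).  Cluster variables are
    therefore studied as functions on such points, where setting a variable to 1
    or passing to another seed is just a change of point, and where a
    one-variable slice of a Laurent polynomial is governed by polynomials in
    one variable.

    The Laurent phenomenon ([laurent_path]) is proved by induction on the length
    of the path.  A path starting with mutations at j, then k, yields two
    expressions, one from the seed after the first step and one from the seed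
    after the steps j, k, j.  Their denominators are coprime once a
    frozen variable that occurs only in the exchange relation at j has been
    added: the exchange polynomial A at j is linear in it, so that working
    modulo A amounts to eliminating it, and the other denominators are
    congruent modulo A to positive functions ([laurent_coprime]).  The added
    variable is then set to 1. *)

Set Implicit Arguments.
Unset Strict Implicit.
Unset Printing Implicit Defensive.

Import Order.TTheory GRing.Theory Num.Theory.
Local Open Scope ring_scope.

(** * Mutations along words, with values in a field *)

Section Mutations.

Variables (I J : finType) (ι : J -> I).

(** Variables are indexed by a finite type [I] and mutable directions by [J],
    embedded in [I] by [ι]: this lets a frozen variable be added by passing from
    [I] to [option I]. *)
Definition mut_mat (i : J) (B : I -> J -> int) (k : I) (j : J) : int :=
  if (k == ι i) || (j == i) then - B k j
  else B k j + ((B k i * `|B (ι i) j| + `|B k i| * B (ι i) j) %/ 2)%Z.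

Definition exch (A : comPzRingType) (i : J) (B : I -> J -> int) (v : I -> A) : A :=
  \prod_k v k ^+ pospart (B k i) + \prod_k v k ^+ pospart (- B k i).

Definition mut_var (F : fieldType) (i : J) (B : I -> J -> int) (v : I -> F) (k : I) : F :=
  if k == ι i then exch i B v / v k else v k.

Fixpoint path_mat (w : seq J) (B : I -> J -> int) : I -> J -> int :=
  if w is i :: w' then path_mat w' (mut_mat i B) else B.

Fixpoint path_var (F : fieldType) (w : seq J) (B : I -> J -> int) (v : I -> F) : I -> F :=
  if w is i :: w' then path_var w' (mut_mat i B) (mut_var i B v) else v.

Definition principal_skew (B : I -> J -> int) : Prop := forall a b, B (ι a) b = - B (ι b) a.

Lemma path_mat_cat w1 w2 B : path_mat (w1 ++ w2) B = path_mat w2 (path_mat w1 B).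
Proof. by elim: w1 B => //= i w1 IH B. Qed.

Lemma path_var_cat (F : fieldType) w1 w2 B (v : I -> F) :
  path_var (w1 ++ w2) B v = path_var w2 (path_mat w1 B) (path_var w1 B v).
Proof. by elim: w1 B v => //= i w1 IH B v. Qed.

Lemma path_var_frozen (F : fieldType) w B (v : I -> F) k :
  (forall j, k != ι j) -> path_var w B v k = v k.
Proof.
by move=> fk; elim: w B v => //= i w IH B v; rewrite IH /mut_var (negPf (fk i)).
Qed.

Hypothesis ι_inj : injective ι.

Lemma skew_diag B i : principal_skew B -> B (ι i) i = 0.
Proof. by move=> /(_ i i); lia. Qed.

Lemma skew_mut i B : principal_skew B -> principal_skew (mut_mat i B).
Proof.
move=> sB a b; rewrite /mut_mat !(inj_eq ι_inj) orbC.
case: ifP => _; first by rewrite sB.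
rewrite (sB b a) (sB i a) (sB b i) !normrN.
have /dvdzP[q e] := dvdz2_mutation (B (ι a) i) (B (ι i) b).
have -> : - B (ι i) b * `|B (ι a) i| + `|B (ι i) b| * - B (ι a) i = - q * 2.
  by rewrite mulNr [in RHS]mulNr -e; ring.
by rewrite e !mulzK //; ring.
Qed.

Lemma skew_path w B : principal_skew B -> principal_skew (path_mat w B).
Proof. by elim: w B => //= i w IH B sB; apply/IH/skew_mut. Qed.

Lemma mut_matK i B : principal_skew B -> mut_mat i (mut_mat i B) = B.
Proof.
move=> sB; apply: functional_extensionality => k.
apply: functional_extensionality => j.
rewrite /mut_mat !eqxx /= !orbT.
case: (_ || _); rewrite ?opprK // !normrN. 
have /dvdzP[q e] := dvdz2_mutation (B k i) (B (ι i) j).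
have -> : - B k i * `|B (ι i) j| + `|B k i| * - B (ι i) j = - q * 2.
  by rewrite [in RHS]mulNr -e; ring.
by rewrite e !mulzK //; ring.
Qed.

Lemma mut_mat_opp i B : mut_mat i (fun k j => - B k j) = fun k j => - mut_mat i B k j.
Proof.
apply: functional_extensionality => k; apply: functional_extensionality => j.
rewrite /mut_mat; case: ifP => // _; rewrite !normrN.
have /dvdzP[q e] := dvdz2_mutation (B k i) (B (ι i) j).
have -> : - B k i * `|B (ι i) j| + `|B k i| * - B (ι i) j = - q * 2.
  by rewrite [in RHS]mulNr -e; ring.
by rewrite e !mulzK //; ring.
Qed.

Lemma mut_var_opp (F : fieldType) i B (v : I -> F) :
  mut_var i (fun k j => - B k j) v = mut_var i B v.
Proof.
apply: functional_extensionality => k; rewrite /mut_var /exch addrC.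
by under [in X in X + _]eq_bigr => j _ do rewrite opprK.
Qed.

Lemma path_var_opp (F : fieldType) w B (v : I -> F) :
  path_var w (fun k j => - B k j) v = path_var w B v.
Proof. by elim: w B v => //= i w IH B v; rewrite mut_mat_opp mut_var_opp IH. Qed.

Lemma exch_mut_mat (A : comPzRingType) i B (v : I -> A) :
  principal_skew B -> exch i (mut_mat i B) v = exch i B v.
Proof.
move=> sB; rewrite /exch addrC; congr (_ + _); apply: eq_bigr => k _;
  by rewrite /mut_mat eqxx orbT ?opprK.
Qed.

Lemma exch_mut_var (F : fieldType) i B (v : I -> F) :
  principal_skew B -> exch i B (mut_var i B v) = exch i B v.
Proof.
move=> sB; congr (_ + _); apply: eq_bigr => k _; rewrite /mut_var;
  by case: eqP => // ->; rewrite skew_diag ?oppr0.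
Qed.

End Mutations.

Section Restriction.

Variables (I I' J : finType) (ι : J -> I) (ι' : J -> I') (e : I -> I').
Hypotheses (e_inj : injective e) (ι'E : forall j, ι' j = e (ι j)).

Lemma big_embed (A : comPzRingType) (f : I' -> A) :
  (forall k, k \notin codom e -> f k = 1) -> \prod_k f k = \prod_k f (e k).
Proof.
move=> f1; rewrite (bigID (mem (codom e))) /= [X in _ * X]big1 // mulr1.
have -> : \prod_(k in codom e) f k = \prod_(k <- codom e) f k.
  by rewrite big_uniq //; exact/injectiveP.
by rewrite big_map enumT.
Qed.

(** Variables equal to 1 can be deleted: they contribute trivially to every
    exchange relation, and mutation never changes an unmutated variable.  Used
    to remove one auxiliary frozen variable ([e := Some]) and to remove all
    frozen variables at once ([e := ι]). *)
Lemma path_var_restrict (F : fieldType) w (B : I -> J -> int) (B' : I' -> J -> int)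
    (v : I -> F) (v' : I' -> F) :
  (forall k j, B' (e k) j = B k j) -> (forall k, v' (e k) = v k) ->
  (forall k, k \notin codom e -> v' k = 1) ->
  forall k, path_var ι' w B' v' (e k) = path_var ι w B v k.
Proof.
elim: w B B' v v' => [|i w IH] B B' v v' eB ev v1 k /=; first exact: ev.
apply: IH => {k}.
- by move=> k j; rewrite /mut_mat ι'E (inj_eq e_inj) !eB.
- move=> k; rewrite /mut_var ι'E (inj_eq e_inj) ev; case: ifP => // _.
  congr (_ / _); rewrite /exch; congr (_ + _); rewrite big_embed.
  + by apply: eq_bigr => j _; rewrite eB ev.
  + by move=> j /v1 ->; rewrite expr1n.
  + by apply: eq_bigr => j _; rewrite eB ev.
  + by move=> j /v1 ->; rewrite expr1n.
- move=> k nk; rewrite /mut_var; case: eqP nk => [->|_ /v1 //].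
  by rewrite ι'E codom_f.
Qed.

End Restriction.

(** * Positive rational points *)

Section PositivePoints.

Variables (I J : finType) (ι : J -> I).
Hypothesis ι_inj : injective ι.

Definition pos (v : I -> rat) : Prop := forall i, 0 < v i.

Lemma exch_gt0 i (B : I -> J -> int) v : pos v -> 0 < exch i B v.
Proof. by move=> pv; apply: addr_gt0; apply: prodr_gt0 => k _; apply/exprn_gt0/pv. Qed.

Lemma pos_mut i B v : pos v -> pos (mut_var ι i B v).
Proof.
by move=> pv k; rewrite /mut_var; case: eqP => // _; rewrite divr_gt0 ?exch_gt0.
Qed.

Lemma pos_path w B v : pos v -> pos (path_var ι w B v).
Proof. by elim: w B v => //= i w IH B v pv; apply/IH/pos_mut. Qed.

Lemma mut_varK i B v : principal_skew ι B -> pos v ->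
  mut_var ι i (mut_mat ι i B) (mut_var ι i B v) = v.
Proof.
move=> sB pv; apply: functional_extensionality => k.
rewrite {1}/mut_var exch_mut_mat // exch_mut_var //.
rewrite /mut_var; case: eqP => // _.
have := exch_gt0 i B pv; have := pv k => vk ek.
by field; rewrite !gt_eqF.
Qed.

Lemma path_matK w B : principal_skew ι B -> path_mat ι (rev w) (path_mat ι w B) = B.
Proof.
elim: w B => //= i w IH B sB.
by rewrite rev_cons -cats1 path_mat_cat IH /= ?mut_matK //; apply: skew_mut.
Qed.

Lemma path_varK w B v : principal_skew ι B -> pos v ->
  path_var ι (rev w) (path_mat ι w B) (path_var ι w B v) = v.
Proof.
elim: w B v => //= i w IH B v sB pv; have sB' := skew_mut ι_inj i sB.
by rewrite rev_cons -cats1 path_var_cat path_matK //= IH ?mut_varK //; apply: pos_mut.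
Qed.

End PositivePoints.

(** * Laurent polynomials as functions on positive points *)

Lemma poly_pos_eq0 (p : {poly rat}) : (forall x, 0 < x -> p.[x] = 0) -> p = 0.
Proof.
move=> p0; apply/eqP/negPn/negP => /max_poly_roots.
move/(_ [seq i.+1%:R | i <- iota 0 (size p)]).
rewrite size_map size_iota ltnn => H; suff: false by []; apply: H.
  by apply/allP => _ /mapP[i _ ->]; rewrite /root p0 ?ltr0Sn.
by rewrite map_inj_uniq ?iota_uniq // => i j /eqP; rewrite eqr_nat => /eqP[].
Qed.

Lemma poly_pos_inj (p q : {poly rat}) : (forall x, 0 < x -> p.[x] = q.[x]) -> p = q.
Proof.
move=> pq; apply/eqP; rewrite -subr_eq0; apply/eqP/poly_pos_eq0 => x x0.
by rewrite hornerD hornerN pq ?subrr.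
Qed.

Section Laurent.

Variable I : finType.
Implicit Types (f g h : (I -> rat) -> rat) (v : I -> rat).

(** An inductive class of functions rather than polynomials with an exponent: the
    properties below are proved along the construction.  The last constructor makes
    membership depend on the values at positive points only. *)
Inductive laurent : ((I -> rat) -> rat) -> Prop :=
| laurentC c : laurent (fun=> c)
| laurentX i : laurent (fun v => v i)
| laurentV i : laurent (fun v => (v i)^-1)
| laurentD f g : laurent f -> laurent g -> laurent (fun v => f v + g v)
| laurentM f g : laurent f -> laurent g -> laurent (fun v => f v * g v)
| laurent_ext f g : (forall v, pos v -> f v = g v) -> laurent f -> laurent g.

Lemma laurent_eq f g : laurent f -> (forall v, pos v -> f v = g v) -> laurent g.
Proof. by move=> lf fg; apply: laurent_ext lf. Qed.

Lemma laurent_exp f n : laurent f -> laurent (fun v => f v ^+ n).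
Proof.
move=> lf; elim: n => [|n IH]; first exact: laurentC.
by apply: (laurent_eq (laurentM lf IH)) => v _; rewrite exprS.
Qed.

Lemma laurentN f : laurent f -> laurent (fun v => - f v).
Proof.
by move=> lf; apply: (laurent_eq (laurentM (laurentC (-1)) lf)) => v _; rewrite mulN1r.
Qed.

Lemma laurent_prod (T : Type) (s : seq T) (F : T -> (I -> rat) -> rat) :
  (forall i, laurent (F i)) -> laurent (fun v => \prod_(i <- s) F i v).
Proof.
move=> lF; elim: s => [|i s IH].
  by apply: (laurent_eq (laurentC 1)) => v _; rewrite big_nil.
by apply: (laurent_eq (laurentM (lF i) IH)) => v _; rewrite big_cons.
Qed.

Lemma laurent_sum (T : Type) (s : seq T) (F : T -> (I -> rat) -> rat) :
  (forall i, laurent (F i)) -> laurent (fun v => \sum_(i <- s) F i v).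
Proof.
move=> lF; elim: s => [|i s IH].
  by apply: (laurent_eq (laurentC 0)) => v _; rewrite big_nil.
by apply: (laurent_eq (laurentD (lF i) IH)) => v _; rewrite big_cons.
Qed.

Lemma laurent_exch (J : finType) (i : J) (B : I -> J -> int) : laurent (exch i B).
Proof. by apply: laurentD; apply: laurent_prod => k; apply/laurent_exp/laurentX. Qed.

Definition set_coord (v : I -> rat) (l : I) (t : rat) : I -> rat :=
  fun i => if i == l then t else v i.

Lemma pos_set_coord v l t : pos v -> 0 < t -> pos (set_coord v l t).
Proof. by move=> pv t0 i; rewrite /set_coord; case: eqP. Qed.

Lemma set_coord_id v l : set_coord v l (v l) = v.
Proof. by apply: functional_extensionality => i; rewrite /set_coord; case: eqP => // ->. Qed.

Definition indep l f := forall v t, pos v -> 0 < t -> f (set_coord v l t) = f v.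

Lemma laurent_slice f l v : laurent f -> pos v ->
  exists N (p : {poly rat}), forall t, 0 < t -> f (set_coord v l t) * t ^+ N = p.[t].
Proof.
move=> lf pv; elim: lf => {f} [c|i|i|f g _ [N [p fp]] _ [M [q gq]]
  |f g _ [N [p fp]] _ [M [q gq]]|f g fg _ [N [p fp]]].
- by exists 0, c%:P => t _; rewrite expr0 mulr1 hornerC.
- exists 0; rewrite /set_coord; case: eqP => _.
    by exists 'X => t _; rewrite expr0 mulr1 hornerX.
  by exists (v i)%:P => t _; rewrite expr0 mulr1 hornerC.
- exists 1; rewrite /set_coord; case: eqP => _.
    by exists 1 => t t0; rewrite expr1 hornerC mulVf ?gt_eqF.
  by exists ((v i)^-1 *: 'X) => t _; rewrite expr1 !hornerE.
- exists (N + M)%N, (p * 'X^M + q * 'X^N) => t t0.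
  by rewrite !hornerE -fp -?gq // exprD; ring.
- exists (N + M)%N, (p * q) => t t0.
  by rewrite hornerM -fp -?gq // exprD; ring.
- by exists N, p => t t0; rewrite -fp // fg //; apply: pos_set_coord.
Qed.

End Laurent.

(** Inverting a coordinate is the only operation that leaves the class when
    Laurent polynomials [G i] are substituted for the coordinates, so a power of
    a common multiple [g] of the [G i] clears the denominators. *)
Lemma laurent_subst (I I' : finType) (f : (I -> rat) -> rat)
    (G : I -> (I' -> rat) -> rat) (g : (I' -> rat) -> rat) :
  laurent f -> (forall v, pos v -> pos (G^~ v)) ->
  (forall i, laurent (G i)) -> laurent g ->
  (forall i, laurent (fun v => (G i v)^-1 * g v)) ->
  exists a, laurent (fun v => f (G^~ v) * g v ^+ a).
Proof.
move=> lf pG lG lg lV; elim: lf => {f} [c|i|i|f h _ [a fa] _ [b hb]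
  |f h _ [a fa] _ [b hb]|f h fh _ [a fa]].
- by exists 0; apply: (laurent_eq (@laurentC I' c)) => v _; rewrite expr0 mulr1.
- by exists 0; apply: (laurent_eq (lG i)) => v _; rewrite expr0 mulr1.
- by exists 1.
- exists (a + b)%N.
  apply: (laurent_eq (laurentD (laurentM fa (laurent_exp b lg))
    (laurentM hb (laurent_exp a lg)))) => v _.
  by rewrite exprD; ring.
- exists (a + b)%N; apply: (laurent_eq (laurentM fa hb)) => v _.
  by rewrite exprD; ring.
- by exists a; apply: (laurent_eq fa) => v pv; rewrite fh //; apply: pG.
Qed.

Ltac laurent_auto := repeat first
  [ assumption | exact: laurentX | exact: laurentV | exact: laurentC
  | apply: laurentD | apply: laurentN | apply: laurentM | apply: laurent_exp ].

(** * Coprimality by elimination of a frozen variable *)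

Section Elimination.

Variables (I : finType) (l : I) (p q : (I -> rat) -> rat).
Hypotheses (p_laurent : laurent p) (q_laurent : laurent q).
Hypotheses (pV_laurent : laurent (fun v => (p v)^-1)) (qV_laurent : laurent (fun v => (q v)^-1)).
Hypotheses (p_gt0 : forall v, pos v -> 0 < p v) (q_gt0 : forall v, pos v -> 0 < q v).
Hypotheses (p_indep : indep l p) (q_indep : indep l q).

Let A v := v l * p v + q v.

Let A_laurent : laurent A.
Proof. by apply: laurentD => //; apply: laurentM => //; apply: laurentX. Qed.

(** Division with remainder by [A], which is linear in the coordinate [l]: since
    v l = - q / p modulo A, and likewise for its inverse, the remainder can be
    made independent of that coordinate. *)
Lemma laurent_divide h : laurent h -> exists h0 h1,
  [/\ laurent h0, laurent h1, indep l h0 & forall v, pos v -> h v = h0 v + A v * h1 v].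
Proof.
elim=> {h} [c|i|i|f g _ [f0 [f1 [lf0 lf1 jf ef]]] _ [g0 [g1 [lg0 lg1 jg eg]]]
  |f g _ [f0 [f1 [lf0 lf1 jf ef]]] _ [g0 [g1 [lg0 lg1 jg eg]]]
  |f g fg _ [f0 [f1 [lf0 lf1 jf ef]]]].
- exists (fun=> c), (fun=> 0); split; try exact: laurentC; first by [].
  by move=> v _; rewrite mulr0 addr0.
- have [->|nil] := eqVneq i l.
    exists (fun v => - (q v * (p v)^-1)), (fun v => (p v)^-1); split => //.
    + exact/laurentN/laurentM.
    + by move=> v t pv t0; rewrite q_indep ?p_indep.
    + by move=> v pv; rewrite /A; field; rewrite gt_eqF ?p_gt0.
  exists (fun v => v i), (fun=> 0); split; first exact: laurentX.
  + exact: laurentC.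
  + by move=> v t pv t0; rewrite /set_coord (negPf nil).
  + by move=> v _; rewrite mulr0 addr0.
- have [->|nil] := eqVneq i l.
    exists (fun v => - (p v * (q v)^-1)), (fun v => (q v)^-1 * (v l)^-1); split => //.
    + exact/laurentN/laurentM.
    + by apply: laurentM => //; apply: laurentV.
    + by move=> v t pv t0; rewrite q_indep ?p_indep.
    + move=> v pv; rewrite /A; have := pv l; have := q_gt0 pv => a b.
      by field; rewrite !gt_eqF.
  exists (fun v => (v i)^-1), (fun=> 0); split; first exact: laurentV.
  + exact: laurentC.
  + by move=> v t pv t0; rewrite /set_coord (negPf nil).
  + by move=> v _; rewrite mulr0 addr0.
- exists (fun v => f0 v + g0 v), (fun v => f1 v + g1 v).
  split; try exact: laurentD.
  + by move=> v t pv t0; rewrite jf ?jg.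
  + by move=> v pv; rewrite ef ?eg //; ring.
- exists (fun v => f0 v * g0 v), (fun v => f0 v * g1 v + g0 v * f1 v + A v * (f1 v * g1 v)).
  split; first exact: laurentM.
  + by laurent_auto.
  + by move=> v t pv t0; rewrite jf ?jg.
  + by move=> v pv; rewrite ef ?eg //; ring.
- by exists f0, f1; split=> // v pv; rewrite -fg ?ef.
Qed.

(** In the variable t = v l, the hypothesis reads h t^N = (p t + q) G(t) with
    [h], [p], [q] constant.  Evaluating at the nonzero root t = - q / p gives h = 0. *)
Lemma dvdA_indep_eq0 h g : indep l h -> laurent g ->
  (forall v, pos v -> h v = A v * g v) -> forall v, pos v -> h v = 0.
Proof.
move=> jh lg e v pv; have [N [G gG]] := laurent_slice l lg pv.
have pp := p_gt0 pv; have qq := q_gt0 pv.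
have /(congr1 (fun P : {poly rat} => P.[- q v / p v])) :
    (h v)%:P * 'X^N = (p v *: 'X + (q v)%:P) * G.
  apply: poly_pos_inj => t t0; rewrite !hornerE -gG //.
  rewrite mulrA -(jh v t pv t0) e; last exact: pos_set_coord.
  by rewrite /A p_indep // q_indep // {1}/set_coord eqxx; ring.
rewrite !(hornerM, hornerD, hornerC, hornerZ, hornerX, hornerXn).
have -> : p v * (- q v / p v) + q v = 0 by field; rewrite gt_eqF.
rewrite mul0r => /eqP; rewrite mulf_eq0 => /orP[/eqP //|].
rewrite expf_eq0 mulf_eq0 oppr_eq0 invr_eq0.
by rewrite (gt_eqF pp) (gt_eqF qq) andbF.
Qed.

(** Such a [g] is invertible modulo [A] in a strong sense: its residue, seen as a
    function on the hypersurface A = 0, has no zero at positive values of the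
    remaining coordinates. *)
Definition positive_mod g := exists s t,
  [/\ laurent s /\ laurent t, indep l s, forall v, pos v -> 0 < s v
    & forall v, pos v -> g v = s v + A v * t v].

Lemma positive_modM f g : positive_mod f -> positive_mod g -> positive_mod (fun v => f v * g v).
Proof.
move=> [s [t [[ls lt] js s0 ef]]] [s' [t' [[ls' lt'] js' s0' eg]]].
exists (fun v => s v * s' v), (fun v => s v * t' v + s' v * t v + A v * (t v * t' v)).
split.
- split; first exact: laurentM.
  by laurent_auto.
- by move=> v z pv z0; rewrite js ?js'.
- by move=> v pv; rewrite mulr_gt0 ?s0 ?s0'.
- by move=> v pv; rewrite ef ?eg //; ring.
Qed.

Lemma positive_mod_exp f n : positive_mod f -> positive_mod (fun v => f v ^+ n).
Proof.
move=> rf; elim: n => [|n IH].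
  exists (fun=> 1), (fun=> 0); split=> //; last by move=> v _; rewrite mulr0 addr0.
  by split; apply: laurentC.
have [s [t [ls js s0 e]]] := positive_modM rf IH.
by exists s, t; split=> // v pv; rewrite exprS e.
Qed.

(** One factor [A] of the denominator is removed at a time.  If A f' is Laurent,
    its remainder modulo [A], multiplied by the positive residue of [g], is
    divisible by [A], hence zero by [dvdA_indep_eq0]. *)
Lemma laurent_coprime f g a : positive_mod g ->
  laurent (fun v => f v * A v ^+ a) -> laurent (fun v => f v * g v) -> laurent f.
Proof.
move=> [s [t [[ls lt] js s0 eg]]] + lfg.
elim: a => [|a IH] lfA.
  by apply: (laurent_eq lfA) => v _; rewrite expr0 mulr1.
apply: IH; have [h0 [h1 [lh0 lh1 jh0 eh]]] := laurent_divide lfA.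
have lAa := laurent_exp a A_laurent.
have A0 v : pos v -> 0 < A v.
  by move=> pv; rewrite addr_gt0 ?mulr_gt0 ?q_gt0 ?p_gt0.
have h00 v : pos v -> h0 v = 0.
  move=> pv; apply: (mulfI (lt0r_neq0 (s0 v pv))); rewrite mulr0.
  (* Multiplying h0 + A h1 = f A^(a+1) by s = g - A t exhibits s h0 as A times k. *)
  pose k v := f v * g v * A v ^+ a - t v * (f v * A v ^+ a.+1) - s v * h1 v.
  apply: (@dvdA_indep_eq0 (fun v => s v * h0 v) k) => //.
  - by move=> w z pw z0; rewrite js ?jh0.
  - by laurent_auto.
  - move=> w pw; have := eh w pw; rewrite /k eg // exprS => e.
    by apply: (@addIr _ (s w * (A w * h1 w))); rewrite -mulrDr -e; ring.
apply: (laurent_eq lh1) => v pv; apply: (mulfI (lt0r_neq0 (A0 v pv))).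
by have := eh v pv; rewrite h00 // add0r => <-; rewrite exprS; ring.
Qed.

End Elimination.

(** * The Laurent phenomenon *)

Section Monomials.

Variable I : finType.
Implicit Types (e f : I -> int) (v w : I -> rat).

Definition mon e v : rat := \prod_k v k ^ e k.

Definition drop_var (j : I) e : I -> int := fun k => if k == j then 0 else e k.

Lemma mon_gt0 e v : pos v -> 0 < mon e v.
Proof. by move=> pv; apply: prodr_gt0 => k _; apply/exprz_gt0/pv. Qed.

Lemma monD e f v : pos v -> mon (fun k => e k + f k) v = mon e v * mon f v.
Proof.
move=> pv; rewrite -big_split; apply: eq_bigr => k _ /=.
by rewrite expfzDr // gt_eqF ?pv.
Qed.

Lemma mon_expn e n v : mon e v ^+ n = mon (fun k => n%:Z * e k) v.
Proof.
by rewrite -prodrXl; apply: eq_bigr => k _; rewrite mulrC -exprz_exp -exprnP.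
Qed.

Lemma monV e v : (mon e v)^-1 = mon (fun k => - e k) v.
Proof. by rewrite -prodfV; apply: eq_bigr => k _; rewrite invr_expz. Qed.

Lemma mon_var j v : mon (fun k => (k == j)%:Z) v = v j.
Proof.
rewrite /mon (bigD1 j) //= eqxx expr1z big1 ?mulr1 // => k /negPf ->.
by rewrite expr0z.
Qed.

Lemma mon_drop j e v : mon e v = v j ^ e j * mon (drop_var j e) v.
Proof.
rewrite /mon (bigD1 j) //= [in RHS](bigD1 j) //= /drop_var eqxx expr0z mul1r.
by congr (_ * _); apply: eq_bigr => k /negPf ->.
Qed.

Lemma eq_mon e f v w :
  (forall k, e k = f k) -> (forall k, e k != 0 -> v k = w k) -> mon e v = mon f w.
Proof.
move=> ef vw; apply: eq_bigr => k _; rewrite -ef.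
by have [->|/vw ->] := eqVneq (e k) 0; rewrite ?expr0z.
Qed.

Lemma mon_indep l e : e l = 0 -> indep l (mon e).
Proof.
move=> el v t _ _; apply: eq_mon => // k.
by rewrite /set_coord; case: (k =P l) => // ->; rewrite el eqxx.
Qed.

Lemma laurent_mon e : laurent (mon e).
Proof.
apply: laurent_prod => k; case: (e k) => n; first exact/laurent_exp/laurentX.
apply: (laurent_eq (laurent_exp n.+1 (laurentV k))) => v _.
by rewrite NegzE exprVn.
Qed.

Lemma exch_mon (J : finType) (i : J) (B : I -> J -> int) v :
  exch i B v = mon (fun k => Num.max 0 (B k i)) v + mon (fun k => Num.max 0 (- B k i)) v.
Proof.
have E z (x : rat) : x ^+ pospart z = x ^ Num.max 0 z.
  by rewrite exprnP; congr (_ ^ _); rewrite /pospart; lia.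
by rewrite /exch; congr (_ + _); apply: eq_bigr => k _; rewrite E.
Qed.

End Monomials.

Section TwoStep.

Variables (I J : finType) (ι : J -> I) (B : I -> J -> int) (j k : J) (l : I).
Hypotheses (ι_inj : injective ι) (B_skew : principal_skew ι B) (j_neq_k : j != k).
Hypotheses (l_frozen : forall i, l != ι i) (Blj : B l j = 1) (Blk : B l k = 0).
Hypothesis Bkj_ge0 : 0 <= B (ι k) j.

Let b := B (ι k) j.
Let B1 := mut_mat ι j B.
Let B2 := mut_mat ι k B1.
Let v1 (v : I -> rat) := mut_var ι j B v.
Let v2 v := mut_var ι k B1 (v1 v).
Let v3 v := mut_var ι j B2 (v2 v).

Let ιjk : (ι j == ι k) = false. Proof. by rewrite (inj_eq ι_inj) (negPf j_neq_k). Qed.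
Let ιkj : (ι k == ι j) = false. Proof. by rewrite eq_sym. Qed.

(* The columns of exponents of the second and third exchange relations. *)
Let c i := B1 i k.
Let d i := B2 i j.

Let cE i : c i = if i == ι j then b else B i k - b * Num.max 0 (- B i j).
Proof.
rewrite /c /B1 /mut_mat [k == j]eq_sym (negPf j_neq_k) orbF (B_skew j k) -/b.
move: Bkj_ge0; rewrite -/b => b0.
by case: eqP => [->|_]; [rewrite (B_skew j k) opprK | nia].
Qed.

Let dE i : d i = if i == ι k then b else - B i j - b * Num.max 0 (- c i).
Proof.
rewrite /d /B2 /mut_mat (negPf j_neq_k) orbF.
have e1 i' : B1 i' j = - B i' j by rewrite /B1 /mut_mat eqxx orbT.
rewrite !e1 -/b -/(c i); move: Bkj_ge0; rewrite -/b => b0.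
by case: eqP => [->|_]; [rewrite opprK | nia].
Qed.

Let A (v : I -> rat) : rat := exch j B v.
Let R := mon (drop_var (ι j) (fun i => Num.max 0 (c i))).
Let S := mon (fun i => Num.max 0 (- c i)).
Let T := mon (drop_var (ι k) (fun i => Num.max 0 (d i))).
Let V := mon (fun i => Num.max 0 (- d i)).
(* [U] is S^b T / v_k^b divided by the second monomial of [A]. *)
Let U := mon (fun i => b * (Num.max 0 (- c i) - (i == ι k)%:Z) +
                 (drop_var (ι k) (fun i => Num.max 0 (d i)) i - Num.max 0 (- B i j))).

Let v1E v i : v1 v i = if i == ι j then A v / v (ι j) else v i.
Proof. by rewrite /v1 /mut_var; case: eqP => // ->. Qed.

Let n := absz b.
Let nb : n%:Z = b. Proof. by rewrite /n; move: Bkj_ge0; rewrite -/b; lia. Qed.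

(** After the first mutation, the variable at j is A / v_j.  Since b >= 0, only one
    of the two monomials of the second exchange relation can contain it, the one
    whose remaining factor is [R]. *)
Let v2_k v : v2 v (ι k) = ((A v / v (ι j)) ^+ n * R v + S v) / v (ι k).
Proof.
rewrite /v2 {1}/mut_var eqxx exch_mon v1E ιkj; congr (_ / _).
have cj : c (ι j) = b by rewrite cE eqxx.
congr (_ + _).
  rewrite (mon_drop (ι j)) v1E eqxx -/(c _) cj max_r // -nb exprnP; congr (_ * _).
  by apply: eq_mon => // i; rewrite /drop_var v1E; case: (i =P ι j).
apply: eq_mon => // i; rewrite v1E -/(c i); case: (i =P ι j) => // ->.
by rewrite cj; move: Bkj_ge0; rewrite -/b; lia.
Qed.

Let v3_j v : v3 v (ι j) = (v2 v (ι k) ^+ n * T v + V v) / (A v / v (ι j)).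
Proof.
have v2E i : v2 v i = if i == ι k then v2 v (ι k) else v1 v i.
  by rewrite /v2 /mut_var; case: eqP => // ->; rewrite eqxx.
rewrite /v3 {1}/mut_var eqxx exch_mon [v2 v (ι j)]v2E ιjk v1E eqxx; congr (_ / _).
have cj : c (ι j) = b by rewrite cE eqxx.
have dk : d (ι k) = b by rewrite dE eqxx.
have dj : d (ι j) = 0.
  by rewrite dE ιjk cj (skew_diag j B_skew); move: Bkj_ge0; rewrite -/b; nia.
congr (_ + _).
  rewrite (mon_drop (ι k)) -/(d _) dk max_r // -nb exprnP; congr (_ * _).
  apply: eq_mon => // i; rewrite /drop_var v2E v1E; case: (i =P ι k) => // _.
  by case: (i =P ι j) => // ->; rewrite -/(d (ι j)) dj.
apply: eq_mon => // i; rewrite v2E v1E -/(d i).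
case: (i =P ι k) => [->|_]; first by rewrite dk; move: Bkj_ge0; rewrite -/b; lia.
by case: (i =P ι j) => // ->; rewrite dj.
Qed.

(** The cancellation behind the Laurent phenomenon: modulo [A] the second variable
    is S / v_k, and the third exchange polynomial evaluated there is a
    monomial times [A].  It is checked on exponents. *)
Let exchange_return v : pos v -> (S v / v (ι k)) ^+ n * T v + V v = U v * A v.
Proof.
move=> pv; rewrite -(mon_var (ι k) v) monV -monD // mon_expn -monD //.
rewrite /A exch_mon mulrDr -!monD // addrC.
have ck : c (ι k) = 0.
  by rewrite cE ιkj -/b (skew_diag k B_skew); move: Bkj_ge0; rewrite -/b; nia.
congr (_ + _); apply: eq_mon => // i; rewrite ?nb /drop_var dE.
  case: eqP => [->|_]; last by lia.
  by rewrite ck -/b; move: Bkj_ge0; rewrite -/b; lia.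
by case: eqP => [->|_]; lia.
Qed.

Let p := mon (drop_var l (fun i => Num.max 0 (B i j))).
Let q := mon (fun i => Num.max 0 (- B i j)).

Let AE v : A v = v l * p v + q v.
Proof. by rewrite /A exch_mon; congr (_ + _); rewrite (mon_drop l) Blj. Qed.

Let ltj : (l == ι j) = false. Proof. exact: negPf. Qed.
Let ltk : (l == ι k) = false. Proof. exact: negPf. Qed.
Let cl : c l = 0. Proof. by rewrite cE ltj Blk Blj; lia. Qed.
Let dl : d l = -1. Proof. by rewrite dE ltk cl Blj; lia. Qed.

Let laurent_A : laurent A. Proof. exact: laurent_exch. Qed.
Let laurent_R : laurent R. Proof. exact: laurent_mon. Qed.
Let laurent_S : laurent S. Proof. exact: laurent_mon. Qed.
Let laurent_T : laurent T. Proof. exact: laurent_mon. Qed.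
Let laurent_U : laurent U. Proof. exact: laurent_mon. Qed.

Let indep_R : indep l R.
Proof. by apply: mon_indep; rewrite /drop_var ltj cl. Qed.
Let indep_S : indep l S.
Proof. by apply: mon_indep; rewrite cl. Qed.
Let indep_T : indep l T.
Proof. by apply: mon_indep; rewrite /drop_var ltk dl. Qed.
Let indep_U : indep l U.
Proof. by apply: mon_indep; rewrite /drop_var ltk dl cl Blj; lia. Qed.

Let set_coord_j v t : set_coord v l t (ι j) = v (ι j).
Proof. by rewrite /set_coord eq_sym ltj. Qed.
Let set_coord_k v t : set_coord v l t (ι k) = v (ι k).
Proof. by rewrite /set_coord eq_sym ltk. Qed.

Let R_gt0 v : pos v -> 0 < R v. Proof. exact: mon_gt0. Qed.
Let S_gt0 v : pos v -> 0 < S v. Proof. exact: mon_gt0. Qed.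
Let T_gt0 v : pos v -> 0 < T v. Proof. exact: mon_gt0. Qed.
Let U_gt0 v : pos v -> 0 < U v. Proof. exact: mon_gt0. Qed.
Let A_gt0 v : pos v -> 0 < A v. Proof. exact: exch_gt0. Qed.

Let v2_positive_mod : positive_mod l p q (fun v => v2 v (ι k)).
Proof.
case n0: n => [|n'].
  exists (fun v => (R v + S v) * (v (ι k))^-1), (fun=> 0); split.
  - by split; laurent_auto.
  - by move=> v t pv t0; rewrite indep_R // indep_S // set_coord_k.
  - by move=> v pv; rewrite divr_gt0 ?addr_gt0 ?R_gt0 ?S_gt0.
  - by move=> v pv; rewrite v2_k n0 expr0 mul1r mulr0 addr0.
exists (fun v => S v * (v (ι k))^-1),
  (fun v => A v ^+ n' * (v (ι j))^-1 ^+ n * (R v * (v (ι k))^-1)); split.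
- by split; laurent_auto.
- by move=> v t pv t0; rewrite indep_S // set_coord_k.
- by move=> v pv; rewrite divr_gt0 ?S_gt0.
- by move=> v pv; rewrite v2_k -AE exprMn n0 [A v ^+ n'.+1]exprS; ring.
Qed.

Let v2_laurent : laurent (fun v => v2 v (ι k)).
Proof.
have [s [t [[ls lt] _ _ e]]] := v2_positive_mod.
apply: (laurent_eq (laurentD ls (laurentM laurent_A lt))) => v pv.
by rewrite e // AE.
Qed.

Let W v := \sum_(i < n) v2 v (ι k) ^+ (n.-1 - i) * (S v / v (ι k)) ^+ i.

Let W_laurent : laurent W.
Proof. by apply: laurent_sum => i; laurent_auto. Qed.

(** By [exchange_return] and the factorisation of x^n - y^n, the division by
    A / v_j in the third exchange relation is exact. *)
Let v3_expand v : pos v ->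
  v3 v (ι j) = U v * v (ι j) + (A v / v (ι j)) ^+ n.-1 * (R v / v (ι k) * T v * W v).
Proof.
move=> pv; have Av := A_gt0 pv; have vj := pv (ι j); have vk := pv (ι k).
rewrite v3_j; apply: (canLR (mulfK _)); first by rewrite mulf_neq0 ?invr_eq0 ?gt_eqF.
rewrite -[v2 v (ι k) ^+ n](subrK ((S v / v (ι k)) ^+ n)) mulrDl -addrA exchange_return //.
have -> : (v2 v (ι k) ^+ n - (S v / v (ι k)) ^+ n) =
    (A v / v (ι j)) ^+ n * (R v / v (ι k)) * W v.
  by rewrite subrXX; congr (_ * _); rewrite v2_k; ring.
have [n0|n0] := posnP n; last by rewrite -{1}(prednK n0) exprS; field; rewrite !gt_eqF.
have -> : W v = 0 by rewrite /W; move: n0 => ->; rewrite big_ord0.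
by field; rewrite !gt_eqF.
Qed.

(** Modulo [A] the second summand of [v3_expand] survives only for n = 1, and it is
    then a positive monomial itself. *)
Let v3_positive_mod : positive_mod l p q (fun v => v3 v (ι j)).
Proof.
have [n1|n1] := eqVneq n 1.
  exists (fun v => U v * v (ι j) + R v * (v (ι k))^-1 * T v), (fun=> 0); split.
  - by split; laurent_auto.
  - by move=> v t pv t0; rewrite indep_R // indep_T // indep_U // set_coord_k set_coord_j.
  - move=> v pv; rewrite addr_gt0 // mulr_gt0 ?U_gt0 ?T_gt0 //.
    by rewrite divr_gt0 ?R_gt0.
  - move=> v pv; rewrite v3_expand // /W n1 big_ord1 !expr0 !mulr1.
    by rewrite mul1r mulr0 addr0.
exists (fun v => U v * v (ι j)),
  (fun v => if n is n'.+2 then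
     A v ^+ n' * (v (ι j))^-1 ^+ n'.+1 * (R v * (v (ι k))^-1 * T v * W v) else 0).
split.
- split; first by laurent_auto.
  by case: n => [|[|n']]; laurent_auto.
- by move=> v t pv t0; rewrite indep_U // set_coord_j.
- by move=> v pv; rewrite mulr_gt0 ?U_gt0.
- move=> v pv; have W0 : n = 0%N -> W v = 0.
    by rewrite /W => ->; rewrite big_ord0.
  rewrite v3_expand // -AE; move: (W v) W0 n1 => w; case: n => [|[|n']] //.
    by move=> -> // _; rewrite !mulr0.
  by move=> _ _ /=; rewrite exprMn [A v ^+ n'.+1]exprS; ring.
Qed.

Let v3_laurent : laurent (fun v => v3 v (ι j)).
Proof.
have [s [t [[ls lt] _ _ e]]] := v3_positive_mod.
apply: (laurent_eq (laurentD ls (laurentM laurent_A lt))) => v pv.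
by rewrite e // AE.
Qed.

(** The seed after one step gives a power of [A] as the only denominator besides
    monomials; the seed after three steps gives a power of the product of the two
    new variables, which is congruent to a positive function modulo [A]. *)
Lemma laurent_two_step (F1 F3 f : (I -> rat) -> rat) :
  laurent F1 -> laurent F3 ->
  (forall v, pos v -> f v = F1 (v1 v)) -> (forall v, pos v -> f v = F3 (v3 v)) ->
  laurent f.
Proof.
move=> lF1 lF3 fF1 fF3.
have p1 v : pos v -> pos (v1 v) by apply: pos_mut.
have p2 v : pos v -> pos (v2 v) by move=> pv; apply/pos_mut/p1.
have p3 v : pos v -> pos (v3 v) by move=> pv; apply/pos_mut/p2.
have l1 i : laurent (v1^~ i).
  case: (i =P ι j) => [->|/eqP/negPf ij].
    apply: (laurent_eq (laurentM laurent_A (laurentV (ι j)))) => v pv.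
    by rewrite v1E eqxx.
  by apply: (laurent_eq (laurentX i)) => v pv; rewrite v1E ij.
have [a la] : exists a, laurent (fun v => F1 (v1 v) * v1 v (ι j) ^+ a).
  apply: (laurent_subst (G := fun i => v1^~ i)) => // i.
  case: (i =P ι j) => [->|/eqP/negPf ij].
    by apply: (laurent_eq (@laurentC I 1)) => v /p1 pv; rewrite mulVf // gt_eqF.
  by apply: (laurent_eq (laurentM (laurentV i) (l1 (ι j)))) => v pv; rewrite [v1 v i]v1E ij.
have v3E v i : v3 v i = if i == ι j then v3 v (ι j) else
    if i == ι k then v2 v (ι k) else v i.
  rewrite {1}/v3 /mut_var; case: (i =P ι j) => [->|/eqP/negPf ij].
    by rewrite /v3 /mut_var eqxx.
  rewrite {1}/v2 /mut_var; case: (i =P ι k) => [->|_].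
    by rewrite /v2 /mut_var eqxx.
  by rewrite v1E ij.
pose g v := v2 v (ι k) * v3 v (ι j).
have lg : laurent g by laurent_auto.
have [a' la'] : exists a, laurent (fun v => F3 (v3 v) * g v ^+ a).
  apply: (laurent_subst (G := fun i => v3^~ i)) => // i.
    case: (i =P ι j) => [->//|/eqP/negPf ij].
    case: (i =P ι k) => [->|/eqP/negPf ik].
      by apply: (laurent_eq v2_laurent) => v pv; rewrite v3E ιkj eqxx.
    by apply: (laurent_eq (laurentX i)) => v pv; rewrite v3E ij ik.
  case: (i =P ι j) => [->|/eqP/negPf ij].
    apply: (laurent_eq v2_laurent) => v pv; rewrite /g mulrCA mulVf ?mulr1 //.
    by rewrite gt_eqF // p3.
  case: (i =P ι k) => [->|/eqP/negPf ik].
    apply: (laurent_eq v3_laurent) => v pv.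
    rewrite [v3 v (ι k)]v3E ιkj eqxx /g mulrA mulVf ?mul1r //.
    by rewrite gt_eqF // p2.
  by apply: (laurent_eq (laurentM (laurentV i) lg)) => v pv; rewrite [v3 v i]v3E ij ik.
have pp : laurent p by apply: laurent_mon.
have qq : laurent q by apply: laurent_mon.
have pV : laurent (fun v => (p v)^-1).
  by apply: (laurent_eq (laurent_mon _)) => v _; rewrite monV.
have qV : laurent (fun v => (q v)^-1).
  by apply: (laurent_eq (laurent_mon _)) => v _; rewrite monV.
have ip : indep l p by apply: mon_indep; rewrite /drop_var eqxx.
have iq : indep l q by apply: mon_indep; rewrite Blj.
have rg : positive_mod l p q (fun v => g v ^+ a').
  by apply: positive_mod_exp => //; apply: positive_modM.
apply: (laurent_coprime pp qq pV qV _ _ ip iq rg (a := a)) => [v|v||].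
- exact: mon_gt0.
- exact: mon_gt0.
- apply: (laurent_eq (laurentM la (laurent_exp a (laurentX (ι j))))) => v pv.
  by rewrite -AE fF1 // -mulrA -exprMn v1E eqxx divfK ?gt_eqF.
- by apply: (laurent_eq la') => v pv; rewrite fF3.
Qed.

End TwoStep.

Lemma laurent_restrict_option (I : finType) (f : (option I -> rat) -> rat) :
  laurent f -> laurent (fun v : I -> rat => f (oapp v 1)).
Proof.
move=> lf; have lG k : laurent (fun v : I -> rat => oapp v 1 k).
  by case: k => [k|] /=; [apply: laurentX | apply: laurentC].
have [] := @laurent_subst _ I f (fun k v => oapp v 1 k) (fun=> 1) lf _ lG.
- by move=> v pv [].
- exact: laurentC.
- case=> [k|] /=; first by apply: (laurent_eq (laurentV k)) => v _; rewrite mulr1.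
  by apply: (laurent_eq (@laurentC I 1)) => v _; rewrite invr1 mulr1.
by move=> a la; apply: (laurent_eq la) => v _; rewrite expr1n mulr1.
Qed.

(** For a path starting with distinct j, k, the induction hypothesis applies to the
    path after j and to the path after j, k, j, in which j is traversed
    once more before the remaining steps; both are shorter than the given path. *)
Theorem laurent_path (I J : finType) (ι : J -> I) (B : I -> J -> int) w i :
  injective ι -> principal_skew ι B -> laurent (fun v => path_var ι w B v i).
Proof.
have [n] := ubnP (size w).
elim: n I J ι B w i => // n IH I J ι B [|j [|k w]] i.
- by move=> *; apply: laurentX.
- move=> _ ι_inj sB; rewrite /= /mut_var; case: eqP => _; last exact: laurentX.
  by apply: laurentM; [apply: laurent_exch | apply: laurentV].
rewrite ltnS => wn ι_inj sB.
have [<-|j_neq_k] := eqVneq j k.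
  apply: (laurent_eq (IH I J ι B w i _ ι_inj sB)); first exact: ltnW.
  by move=> v pv /=; rewrite mut_matK // mut_varK.
(* Changing the sign of [B] exchanges the two monomials of every exchange
   relation, so it changes no cluster variable. *)
wlog Bkj : B sB / 0 <= B (ι k) j.
  move=> H; have [/H|Bkj] := boolP (0 <= B (ι k) j); first exact.
  apply: (laurent_eq (H (fun a b => - B a b) _ _)) => [a b||v _].
  - by rewrite sB.
  - by rewrite oppr_ge0; lia.
  - by rewrite path_var_opp.
(* The new frozen variable [None] occurs in the exchange relation at [j] only. *)
pose B' (o : option I) (a : J) := if o is Some x then B x a else (a == j)%:Z.
pose ι' a := Some (ι a).
have ι'_inj : injective ι' by move=> a b [] /ι_inj.
have sB' : principal_skew ι' B' by [].
have lk a : None != ι' a by [].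
have sB1 := skew_mut ι'_inj j sB'; have sB2 := skew_mut ι'_inj k sB1.
have sB3 := skew_mut ι'_inj j sB2.
suff lf : laurent (fun v => path_var ι' [:: j, k & w] B' v (Some i)).
  apply: (laurent_eq (laurent_restrict_option lf)) => v _.
  apply: (path_var_restrict (e := Some)) => //; first by move=> x y [].
  by case=> // x; rewrite codom_f.
apply: (laurent_two_step ι'_inj sB' j_neq_k lk _ _ _
  (IH _ _ ι' (mut_mat ι' j B') (k :: w) (Some i) _ ι'_inj sB1)
  (IH _ _ ι' (mut_mat ι' j (mut_mat ι' k (mut_mat ι' j B'))) (j :: w)
     (Some i) _ ι'_inj sB3)) => //.
- by rewrite /= eqxx.
- by rewrite /= eq_sym (negPf j_neq_k).
- move=> v pv /=; rewrite mut_matK // mut_varK //.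
  by do 2!apply: pos_mut.
Qed.

(** * Growth along coordinate curves *)

Section Degree.

(** [D] is the exponent of growth of [g] at infinity.  Positive leading
    coefficients exclude cancellation in sums, so that the exponent of a sum is
    the maximum of the exponents ([has_degD]). *)
Definition has_deg (g : rat -> rat) (D : int) : Prop := exists p q : {poly rat},
  [/\ 0 < lead_coef p, 0 < lead_coef q, forall t, 0 < t -> g t * q.[t] = p.[t]
    & D = (size p)%:Z - (size q)%:Z].

Lemma lead_gt0_neq0 (p : {poly rat}) : 0 < lead_coef p -> p != 0.
Proof. by rewrite -lead_coef_eq0 => /lt0r_neq0. Qed.

Lemma fraction_deg (g : rat -> rat) (p q p' q' : {poly rat}) :
  p != 0 -> q != 0 -> p' != 0 -> q' != 0 ->
  (forall t, 0 < t -> g t * q.[t] = p.[t]) ->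
  (forall t, 0 < t -> g t * q'.[t] = p'.[t]) ->
  (size p + size q' = size p' + size q)%N.
Proof.
move=> p0 q0 p0' q0' e e'.
have /(congr1 (fun P : {poly rat} => size P)) : p * q' = p' * q.
  by apply: poly_pos_inj => t t0; rewrite !hornerM -e // -e' //; ring.
rewrite !size_mul //; move: p0 p0'; rewrite -!size_poly_gt0.
by move: (size p) (size q) (size p') (size q') => a b c d; lia.
Qed.

Lemma has_deg_unique g D D' : has_deg g D -> has_deg g D' -> D = D'.
Proof.
move=> [p [q [/lead_gt0_neq0 p0 /lead_gt0_neq0 q0 e ->]]].
move=> [p' [q' [/lead_gt0_neq0 p0' /lead_gt0_neq0 q0' e' ->]]].
by have := fraction_deg p0 q0 p0' q0' e e'; lia.
Qed.

Lemma eq_has_deg g h D : (forall t, 0 < t -> g t = h t) -> has_deg g D -> has_deg h D.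
Proof.
move=> gh [p [q [p0 q0 e ->]]]; exists p, q; split=> // t t0.
by rewrite -gh ?e.
Qed.

Lemma has_degC c : 0 < c -> has_deg (fun=> c) 0.
Proof.
move=> c0; exists c%:P, 1; rewrite lead_coefC lead_coef1; split=> //.
  by move=> t _; rewrite !hornerC mulr1.
by rewrite size_polyC size_poly1 gt_eqF.
Qed.

Lemma has_degX : has_deg id 1.
Proof.
exists 'X, 1; rewrite lead_coefX lead_coef1; split=> //.
  by move=> t _; rewrite hornerC hornerX mulr1.
by rewrite size_polyX size_poly1.
Qed.

Lemma has_degV g D : (forall t, 0 < t -> 0 < g t) -> has_deg g D ->
  has_deg (fun t => (g t)^-1) (- D).
Proof.
move=> g0 [p [q [p0 q0 e ->]]]; exists q, p; split=> //; last by rewrite opprB.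
by move=> t t0; rewrite -e // mulKf // gt_eqF ?g0.
Qed.

Lemma has_degM g h D E : has_deg g D -> has_deg h E ->
  has_deg (fun t => g t * h t) (D + E).
Proof.
move=> [p [q [p0 q0 e ->]]] [p' [q' [p0' q0' e' ->]]].
exists (p * p'), (q * q'); rewrite !lead_coefM; split; try exact: mulr_gt0.
  by move=> t t0; rewrite !hornerM -e // -e' //; ring.
move: p0 q0 p0' q0' => /lead_gt0_neq0 p0 /lead_gt0_neq0 q0.
move=> /lead_gt0_neq0 p0' /lead_gt0_neq0 q0'; rewrite !size_mul //.
move: p0 q0 p0' q0'; rewrite -!size_poly_gt0.
by move: (size p) (size q) (size p') (size q') => a b c d; lia.
Qed.

Lemma has_deg_exp g D n : has_deg g D -> has_deg (fun t => g t ^+ n) (D *+ n).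
Proof.
move=> gD; elim: n => [|n IH].
  by rewrite mulr0n; apply: eq_has_deg (has_degC ltr01).
rewrite mulrS; apply: eq_has_deg (has_degM gD IH) => t _.
by rewrite exprS.
Qed.

Lemma lead_coefD_gt0 (p q : {poly rat}) : 0 < lead_coef p -> 0 < lead_coef q ->
  0 < lead_coef (p + q) /\ size (p + q) = maxn (size p) (size q).
Proof.
wlog pq : p q / (size q <= size p)%N => [H p0 q0|p0 q0].
  have /orP[/H H'|/H H'] := leq_total (size q) (size p); first exact: H'.
  by rewrite addrC maxnC; exact: H'.
have [eqpq|npq] := eqVneq (size q) (size p); last first.
  have lt : (size q < size p)%N by rewrite ltn_neqAle npq.
  by rewrite lead_coefDl // size_polyDl //; split=> //; rewrite (maxn_idPl pq).
have c0 : 0 < (p + q)`_(size p).-1.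
  by rewrite coefD -{2}eqpq; apply: addr_gt0.
have s : size (p + q) = size p.
  apply/eqP; rewrite eqn_leq (leq_trans (size_polyD _ _)) ?eqpq ?maxnn //=.
  rewrite -(prednK (_ : 0 < size p)%N) ?size_poly_gt0 ?lead_gt0_neq0 //.
  by rewrite ltnNge; apply/negP => /leq_sizeP/(_ _ (leqnn _)) e; rewrite e in c0.
by rewrite eqpq maxnn /lead_coef s.
Qed.

Lemma has_degD g h D E : has_deg g D -> has_deg h E ->
  has_deg (fun t => g t + h t) (Num.max D E).
Proof.
move=> [p [q [p0 q0 e ->]]] [p' [q' [p0' q0' e' ->]]].
have := @lead_coefD_gt0 (p * q') (p' * q); rewrite !lead_coefM => [][||l s].
- exact: mulr_gt0.
- exact: mulr_gt0.
exists (p * q' + p' * q), (q * q'); rewrite lead_coefM; split=> //; first exact: mulr_gt0.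
  by move=> t t0; rewrite hornerD !hornerM -e // -e' //; ring.
move: p0 q0 p0' q0' => /lead_gt0_neq0 p0 /lead_gt0_neq0 q0.
move=> /lead_gt0_neq0 p0' /lead_gt0_neq0 q0'; rewrite s !size_mul //.
move: p0 q0 p0' q0'; rewrite -!size_poly_gt0.
by move: (size p) (size q) (size p') (size q') => a b c d; lia.
Qed.

Lemma has_deg_prod (T : Type) (s : seq T) (F : T -> rat -> rat) (D : T -> int) :
  (forall i, has_deg (F i) (D i)) ->
  has_deg (fun t => \prod_(i <- s) F i t) (\sum_(i <- s) D i).
Proof.
move=> FD; elim: s => [|i s IH].
  by rewrite big_nil; apply: eq_has_deg (has_degC ltr01) => t _; rewrite big_nil.
rewrite big_cons; apply: eq_has_deg (has_degM (FD i) IH) => t _.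
by rewrite big_cons.
Qed.

Variables (I J : finType) (ι : J -> I).

Definition trop_exch (i : J) (B : I -> J -> int) (a : I -> int) : int :=
  Num.max (\sum_k a k *+ pospart (B k i)) (\sum_k a k *+ pospart (- B k i)).

Definition trop_mut (i : J) (B : I -> J -> int) (a : I -> int) (k : I) : int :=
  if k == ι i then trop_exch i B a - a k else a k.

Fixpoint trop_path (w : seq J) (B : I -> J -> int) (a : I -> int) : I -> int :=
  if w is i :: w' then trop_path w' (mut_mat ι i B) (trop_mut i B a) else a.

(** The exponent is computed by the tropical exchange relations from the exponents
    of the initial variables alone, so it is the same for all curves with these
    exponents. *)
Lemma has_deg_path w B (U : rat -> I -> rat) (a : I -> int) :
  (forall t, 0 < t -> pos (U t)) -> (forall k, has_deg (U^~ k) (a k)) ->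
  forall k, has_deg (fun t => path_var ι w B (U t) k) (trop_path w B a k).
Proof.
elim: w B U a => [|i w IH] B U a pU Ua //=.
apply: IH => [t t0|k]; first exact/pos_mut/pU.
rewrite /mut_var /trop_mut; case: eqP => // _.
apply: has_degM; last by apply: has_degV => // t t0; apply: pU.
by apply: has_degD; apply: has_deg_prod => j; apply: has_deg_exp.
Qed.

End Degree.

(** * Laurent polynomials in one variable with prescribed growth *)

(** The exponent at infinity is the degree of the numerator minus [N]; the exponent
    at 0, read on the numerator with reversed coefficients, leaves a single term. *)
Lemma slice_const (h : rat -> rat) N (p : {poly rat}) :
  (forall t, 0 < t -> h t * t ^+ N = p.[t]) ->
  has_deg h 0 -> has_deg (fun t => h t^-1) 0 ->
  forall t, 0 < t -> h t = h 1.
Proof.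
move=> hp [p1 [q1 [/lead_gt0_neq0 p10 /lead_gt0_neq0 q10 e1 s1]]].
move=> [p2 [q2 [/lead_gt0_neq0 p20 /lead_gt0_neq0 q20 e2 s2]]].
have X0 : 'X^N != 0 :> {poly rat} by rewrite expf_neq0 // polyX_eq0.
have p0 : p != 0.
  apply: contraNneq p10 => p0; apply/eqP/poly_pos_eq0 => t t0.
  apply/eqP; rewrite -e1 // mulf_eq0; apply/orP; left.
  have /eqP := hp t t0; rewrite p0 horner0 mulf_eq0 expf_eq0.
  by rewrite (gt_eqF t0) andbF orbF.
have hp' t : 0 < t -> h t * 'X^N.[t] = p.[t] by rewrite hornerXn; apply: hp.
have sp : size p = N.+1.
  by have := fraction_deg p0 X0 p10 q10 hp' e1; rewrite size_polyXn; lia.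
(* The polynomial [p] with reversed coefficients, giving t |-> h (1 / t). *)
pose r := \poly_(k < N.+1) p`_(N - k).
have hr t : 0 < t -> h t^-1 * (1 : {poly rat}).[t] = r.[t].
  move=> t0; rewrite hornerC mulr1; have tV0 : 0 < t^-1 by rewrite invr_gt0.
  have tN : t^-1 ^+ N != 0 by rewrite expf_neq0 // gt_eqF.
  apply: (mulIf tN); rewrite hp // horner_poly mulr_suml.
  rewrite (horner_coef_wide _ (eq_leq sp)) (reindex_inj rev_ord_inj) /=.
  apply: eq_bigr => k _; rewrite subSS -mulrA; congr (_ * _).
  have kN : (k <= N)%N by rewrite -ltnS.
  have -> : t^-1 ^+ N = t^-1 ^+ k * t^-1 ^+ (N - k) by rewrite -exprD subnKC.
  by rewrite mulrA -exprMn mulfV ?gt_eqF // expr1n mul1r.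
have r0 : r != 0.
  apply: contraNneq p20 => r0; apply/eqP/poly_pos_eq0 => t t0.
  by rewrite -e2 //; move: (hr t t0); rewrite r0 horner0 hornerC mulr1 => ->; rewrite mul0r.
have sr : (size r <= 1)%N.
  by have := fraction_deg r0 (oner_neq0 _) p20 q20 hr e2; rewrite size_poly1; lia.
move=> t t0; have := hr t^-1; rewrite invrK invr_gt0 => /(_ t0).
have := hr 1 ltr01; rewrite (size1_polyC sr) !hornerC !mulr1 invr1 => ->.
by [].
Qed.

(** The numerators of [h] and of its inverse divide a power of the variable, so they
    are monomials; the exponent at 0 then says which one. *)
Lemma slice_unit_const (h : rat -> rat) N M (p q : {poly rat}) :
  (forall t, 0 < t -> 0 < h t) ->
  (forall t, 0 < t -> h t * t ^+ N = p.[t]) ->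
  (forall t, 0 < t -> (h t)^-1 * t ^+ M = q.[t]) ->
  has_deg (fun t => h t^-1) 0 ->
  forall t, 0 < t -> h t = h 1.
Proof.
move=> h0 hp hq [p2 [q2 [/lead_gt0_neq0 p20 /lead_gt0_neq0 q20 e2 s2]]].
have pq : p * q = 'X^(N + M).
  apply: poly_pos_inj => t t0; rewrite hornerM -hp // -hq // hornerXn exprD.
  by rewrite mulrACA mulfV ?mul1r // gt_eqF ?h0.
have : p %| ('X - 0%:P) ^+ (N + M) by rewrite subr0 -pq dvdp_mulr.
case/dvdp_exp_XsubCP => e _ /eqpP[[c1 c2] /= /andP[c10 c20]].
rewrite subr0 => /(congr1 (fun P : {poly rat} => P.[_])) pe.
have {}hp t : 0 < t -> h t * t ^+ N = (c2 / c1) * t ^+ e.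
  move=> t0; rewrite hp //; apply: (mulfI c10).
  by have := pe t; rewrite !hornerZ hornerXn => ->; field.
have eN : e = N.
  have XN n : 'X^n != 0 :> {poly rat} by rewrite expf_neq0 // polyX_eq0.
  have c0 : (c2 / c1)%:P * 'X^N != 0.
    by rewrite mulf_neq0 // polyC_eq0 mulf_neq0 // invr_eq0.
  have e' t : 0 < t -> h t^-1 * 'X^e.[t] = ((c2 / c1)%:P * 'X^N).[t].
    move=> t0; have := hp t^-1; rewrite invr_gt0 => /(_ t0).
    rewrite !exprVn => /(canRL (divfK _)) ->; last first.
      by rewrite expf_neq0 // gt_eqF.
    rewrite hornerM hornerC !hornerXn -[LHS]mulrA [t ^+ N * _]mulrC mulrA.
    by rewrite divfK // expf_neq0 // gt_eqF.
  have := fraction_deg c0 (XN e) p20 q20 e' e2.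
  rewrite size_Cmul ?mulf_neq0 ?invr_eq0 // !size_polyXn.
  by move: s2; move: (size p2) (size q2) => a b; lia.
have hc t : 0 < t -> h t = c2 / c1.
  move=> t0; have := hp t t0; rewrite eN; apply: mulIf.
  by rewrite expf_neq0 // gt_eqF.
by move=> t t0; rewrite !hc.
Qed.

(** A frozen variable [l] occurs in at most one of the two monomials of an exchange
    relation, so along a curve where it tends to 0 and the other variables
    stay fixed the right-hand side of every exchange relation keeps order 0. *)
Lemma trop_path_frozen (I J : finType) (ι : J -> I) l w B :
  (forall j, l != ι j) ->
  trop_path ι w B (fun k => - (k == l)%:Z) = (fun k => - (k == l)%:Z).
Proof.
move=> fl; elim: w B => //= i w IH B; rewrite -[RHS](IH (mut_mat ι i B)).
congr (trop_path _ _ _ _); apply: functional_extensionality => k.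
rewrite /trop_mut; case: eqP => // ->; rewrite eq_sym (negPf (fl i)) oppr0 subr0.
have S n : \sum_k (- (k == l)%:Z) *+ n k = - (n l)%:Z.
  rewrite (bigD1 l) //= eqxx big1 ?addr0 => [|x /negPf ->]; last by rewrite oppr0 mul0rn.
  by rewrite mulNrn; congr (- _); rewrite -mulr_natr mul1r natz.
by rewrite /trop_exch !S /pospart; lia.
Qed.

Lemma eq_off_indep (I : finType) (f : (I -> rat) -> rat) (P : pred I) v w :
  (forall l, P l -> indep l f) -> pos v -> pos w ->
  (forall k, ~~ P k -> v k = w k) -> f v = f w.
Proof.
move=> jf pv pw vw.
pose u (s : seq I) k := if k \in s then w k else v k.
have pu s : pos (u s) by move=> k; rewrite /u; case: ifP.
have fu s : f (u s) = f v.
  elim: s => [|l s <-].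
    by congr f; apply: functional_extensionality.
  have -> : u (l :: s) = set_coord (u s) l (w l).
    apply: functional_extensionality => k; rewrite /u /set_coord in_cons.
    by case: (k =P l) => [->|].
  have [Pl|Pl] := boolP (P l); first by rewrite jf.
  congr f; apply: functional_extensionality => k; rewrite /set_coord /u.
  by case: (k =P l) => // ->; rewrite vw ?if_same.
rewrite -(fu (enum I)); congr f; apply: functional_extensionality => k.
by rewrite /u mem_enum.
Qed.

(** * Coincidences and frozen variables *)

Section FrozenVariables.

Variables (I J : finType) (ι : J -> I).
Hypothesis ι_inj : injective ι.

Definition frozen_one (v : I -> rat) : Prop := forall k, k \notin codom ι -> v k = 1.

Lemma notin_codomP k : k \notin codom ι -> forall j, k != ι j.
Proof. by move=> nk j; apply: contraNneq nk => ->; apply: codom_f. Qed.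

Definition ratio B w i j (v : I -> rat) : rat := path_var ι w B v (ι i) / v (ι j).

Lemma ratio_gt0 B w i j v : pos v -> 0 < ratio B w i j v.
Proof. by move=> pv; rewrite divr_gt0 ?pos_path. Qed.

Lemma laurent_ratio B w i j : principal_skew ι B -> laurent (ratio B w i j).
Proof. by move=> sB; apply: laurentM; [apply: laurent_path | apply: laurentV]. Qed.

Lemma has_deg_ratio B w i j l v : pos v ->
  has_deg (fun t => ratio B w i j (set_coord v l t))
    (trop_path ι w B (fun k => (k == l)%:Z) (ι i) - (ι j == l)%:Z).
Proof.
move=> pv; have pU t : 0 < t -> pos (set_coord v l t) by apply: pos_set_coord.
have dU k : has_deg (fun t => set_coord v l t k) (k == l)%:Z.
  by rewrite /set_coord; case: eqP => _; [apply: has_degX | apply: has_degC].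
apply: has_degM; first exact: has_deg_path.
by apply: has_degV => // t t0; apply: pU.
Qed.

Lemma has_deg_ratioV B w i j l v : pos v ->
  has_deg (fun t => ratio B w i j (set_coord v l t^-1))
    (trop_path ι w B (fun k => - (k == l)%:Z) (ι i) + (ι j == l)%:Z).
Proof.
move=> pv; have pU t : 0 < t -> pos (set_coord v l t^-1).
  by move=> t0; apply: pos_set_coord => //; rewrite invr_gt0.
have dU k : has_deg (fun t => set_coord v l t^-1 k) (- (k == l)%:Z).
  rewrite /set_coord; case: eqP => _; last by rewrite oppr0; apply: has_degC.
  by apply: has_degV => //; apply: has_degX.
apply: has_degM; first exact: has_deg_path.
by rewrite -[X in has_deg _ X]opprK; apply: has_degV => // t t0; apply: pU.
Qed.

(** The exponents of growth in a mutable coordinate do not depend on the other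
    coordinates, and they are 0 at the point with all coordinates 1, around which
    the ratio is constant in that direction. *)
Lemma ratio_indep_mutable B w i j a :
  principal_skew ι B ->
  (forall v, pos v -> frozen_one v -> path_var ι w B v (ι i) = v (ι j)) ->
  indep (ι a) (ratio B w i j).
Proof.
move=> sB H v t pv t0; rewrite -[in RHS](set_coord_id v (ι a)).
have p1 : pos (fun _ : I => 1) by [].
have r1 s : 0 < s -> ratio B w i j (set_coord (fun=> 1) (ι a) s) = 1.
  move=> s0; have pu : pos (set_coord (fun=> 1) (ι a) s) by apply: pos_set_coord.
  rewrite /ratio H ?mulfV ?gt_eqF // => k nk.
  by rewrite /set_coord (negPf (notin_codomP nk a)).
have r2 s : 0 < s -> ratio B w i j (set_coord (fun=> 1) (ι a) s^-1) = 1.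
  by rewrite -invr_gt0; apply: r1.
have d1 := has_deg_ratio B w i j (ι a); have d2 := has_deg_ratioV B w i j (ι a).
have e1 := has_deg_unique (eq_has_deg r1 (d1 _ p1)) (has_degC ltr01).
have e2 := has_deg_unique (eq_has_deg r2 (d2 _ p1)) (has_degC ltr01).
have [N [p hp]] := laurent_slice (ι a) (laurent_ratio w i j sB) pv.
have := slice_const hp; have := d1 _ pv; have := d2 _ pv; rewrite e1 e2.
by move=> D2 D1 C; rewrite C // [RHS]C.
Qed.

(** The inverse of the ratio is the ratio for the reversed path, read at the final
    seed.  Both depend only on frozen variables, which are common to all seeds, so
    they are inverse Laurent polynomials in the same variables. *)
Lemma ratio_eq1 B w i j :
  principal_skew ι B ->
  (forall v, pos v -> frozen_one v -> path_var ι w B v (ι i) = v (ι j)) ->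
  forall v, pos v -> path_var ι w B v (ι i) = v (ι j).
Proof.
move=> sB H; pose Bs := path_mat ι w B; have sBs := skew_path ι_inj w sB.
have frozenE u k : k \notin codom ι -> path_var ι w B u k = u k :> rat.
  by move=> /notin_codomP; apply: path_var_frozen.
have Hs v : pos v -> frozen_one v -> path_var ι (rev w) Bs v (ι j) = v (ι i).
  move=> pv fv; set u := path_var _ _ _ v.
  have uv : path_var ι w B u = v.
    by rewrite /u -{1}[w]revK -{1}[B](path_matK ι_inj w sB) path_varK.
  have pu : pos u by apply: pos_path.
  rewrite -[in RHS]uv H // => k nk.
  by rewrite /u path_var_frozen ?fv //; apply: notin_codomP.
have inv v : pos v -> ratio B w i j v * ratio Bs (rev w) j i v = 1.
  move=> pv; have pw : pos (path_var ι w B v) by apply: pos_path.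
  rewrite (@eq_off_indep _ (ratio Bs (rev w) j i) (mem (codom ι)) v (path_var ι w B v) _ pv pw).
  - rewrite /ratio path_varK //; have := pv (ι j); have := pw (ι i) => a b.
    by field; rewrite !gt_eqF.
  - by move=> _ /codomP[a ->]; apply: ratio_indep_mutable.
  - by move=> k nk; rewrite frozenE.
have indep_all l : indep l (ratio B w i j).
  have [/codomP[a ->]|nl] := boolP (l \in codom ι); first exact: ratio_indep_mutable.
  move=> v t pv t0; rewrite -[in RHS](set_coord_id v l).
  have pU s : 0 < s -> pos (set_coord v l s) by apply: pos_set_coord.
  have [N [p hp]] := laurent_slice l (laurent_ratio w i j sB) pv.
  have [M [q hq]] := laurent_slice l (laurent_ratio (rev w) j i sBs) pv.
  have hq' s : 0 < s -> (ratio B w i j (set_coord v l s))^-1 * s ^+ M = q.[s].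
    move=> s0; rewrite -hq //; congr (_ * _).
    have g0 := ratio_gt0 B w i j (pU s s0).
    by apply: (mulfI (lt0r_neq0 g0)); rewrite inv ?mulfV ?gt_eqF //; apply: pU.
  have D := has_deg_ratioV B w i j l pv.
  have nl' x : (ι x == l) = false by rewrite eq_sym (negPf (notin_codomP nl x)).
  rewrite trop_path_frozen ?nl' ?oppr0 ?addr0 in D; last exact: notin_codomP.
  have h0 s : 0 < s -> 0 < ratio B w i j (set_coord v l s).
    by move=> /pU; apply: ratio_gt0.
  by have C := slice_unit_const h0 hp hq' D; rewrite C // [RHS]C.
move=> v pv; have vj := pv (ι j).
rewrite -[LHS](divfK (lt0r_neq0 vj)) -/(ratio B w i j v).
rewrite (@eq_off_indep _ (ratio B w i j) predT v (fun=> 1)) //.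
by rewrite /ratio H // divr1 mul1r.
Qed.

End FrozenVariables.

Section CoefficientFree.

Variables (I J : finType) (ι : J -> I).
Hypothesis ι_inj : injective ι.

(** Conjugating by the path [w'] makes the variable at [j] an initial one, so that
    [ratio_eq1] applies to the path from the seed of [w'] to that of [w]. *)
Lemma path_eq_frozen_one B w w' i j :
  principal_skew ι B ->
  (forall v, pos v -> frozen_one ι v ->
     path_var ι w B v (ι i) = path_var ι w' B v (ι j)) ->
  forall v, pos v -> path_var ι w B v (ι i) = path_var ι w' B v (ι j).
Proof.
move=> sB H v pv; have sBt := skew_path ι_inj w' sB.
have sigmaE z : path_var ι (rev w' ++ w) (path_mat ι w' B) z =
    path_var ι w B (path_var ι (rev w') (path_mat ι w' B) z).
  by rewrite path_var_cat path_matK.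
have returnE z : pos z ->
    path_var ι w' B (path_var ι (rev w') (path_mat ι w' B) z) = z.
  by move=> pz; rewrite -{1}[w']revK -{1}[B](path_matK ι_inj w' sB) path_varK.
rewrite -[RHS](ratio_eq1 (w := rev w' ++ w) ι_inj sBt (i := i)) => [|z|].
- by rewrite sigmaE path_varK.
- move=> pz fz; rewrite sigmaE H ?returnE //; first exact: pos_path.
  by move=> k nk; rewrite path_var_frozen ?fz //; apply: notin_codomP.
- exact: pos_path.
Qed.

(** Setting the frozen variables to 1 turns a coincidence into one in the algebra
    without frozen variables; [path_eq_frozen_one] provides the converse. *)
Lemma path_eq_principal B w w' i j :
  principal_skew ι B ->
  (forall v, pos v -> path_var ι w B v (ι i) = path_var ι w' B v (ι j)) <->
  (forall v, pos v -> path_var id w (fun a b => B (ι a) b) v i =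
                      path_var id w' (fun a b => B (ι a) b) v j).
Proof.
move=> sB.
have restrict (v : I -> rat) u a : frozen_one ι v ->
    path_var ι u B v (ι a) = path_var id u (fun a b => B (ι a) b) (v \o ι) a.
  by move=> fv; apply: path_var_restrict.
split=> H v pv; last first.
  apply: path_eq_frozen_one v pv => // v pv fv.
  by rewrite !restrict // H // => a; apply: pv.
(* The point [v] of the mutable coordinates, completed by 1 at the frozen ones. *)
pose v' k := if [pick a | ι a == k] is Some a then v a else 1.
have v'E a : v' (ι a) = v a.
  rewrite /v'; case: pickP => [b /eqP/ι_inj -> //|/(_ a)].
  by rewrite eqxx.
have v'v : v' \o ι = v by apply: functional_extensionality.
have pv' : pos v' by move=> k; rewrite /v'; case: pickP.
have fv' : frozen_one ι v'.
  move=> k nk; rewrite /v'; case: pickP => // a /eqP ak.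
  by rewrite -ak codom_f in nk.
by have := H v' pv'; rewrite !restrict // v'v.
Qed.

End CoefficientFree.

(** * From rational functions to functions on positive points *)

Lemma sum_base_inj K n (a b : nat -> nat) :
  (forall i, a i < K)%N -> (forall i, b i < K)%N ->
  (\sum_(i < n) a i * K ^ i = \sum_(i < n) b i * K ^ i)%N ->
  forall i, (i < n)%N -> a i = b i.
Proof.
elim: n a b => // n IH a b aK bK.
have K0 : (0 < K)%N by apply: leq_ltn_trans (aK 0%N).
have shift (c : nat -> nat) : (\sum_(i < n.+1) c i * K ^ i =
    (\sum_(i < n) c i.+1 * K ^ i) * K + c 0)%N.
  rewrite big_ord_recl expn0 muln1 addnC big_distrl /=; congr (_ + _)%N.
  by apply: eq_bigr => i _; rewrite /bump /= add1n expnSr mulnA.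
rewrite !shift => e.
have e0 : a 0 = b 0 by have := congr1 (modn^~ K) e; rewrite !modnMDl !modn_small.
case=> [|i] // iln; apply: (IH (a \o succn) (b \o succn)) => // [x|x|].
- exact: aK.
- exact: bK.
- by move/eqP: e; rewrite e0 eqn_add2r eqn_pmul2r // => /eqP.
Qed.

(** Kronecker substitution: x_i is replaced by t^(K^i) with [K] larger than all
    exponents, so that distinct monomials have distinct images, by uniqueness of
    expansions in base [K]. *)
Lemma mpoly_pos_eq0 n (p : {mpoly rat[n]}) :
  (forall v : 'I_n -> rat, pos v -> p.@[v] = 0) -> p = 0.
Proof.
move=> p0; pose K := (msize p).+1.
pose code (m : 'X_{1..n}) := (\sum_(i < n) m i * K ^ i)%N.
pose P : {poly rat} := \sum_(m <- msupp p) p@_m *: 'X^(code m).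
have P0 : P = 0.
  apply: poly_pos_eq0 => t t0; rewrite -(p0 (fun i => t ^+ (K ^ i)%N)); last first.
    by move=> i; apply: exprn_gt0.
  rewrite /P horner_sum mevalE; apply: eq_bigr => m _.
  rewrite hornerZ hornerXn; congr (_ * _); rewrite /code.
  rewrite -prodrXr; apply: eq_bigr => i _.
  by rewrite -exprM mulnC.
have small m i : m \in msupp p -> (m i < K)%N.
  move=> /msize_mdeg_lt mp; rewrite /K ltnS; apply: leq_trans (ltnW mp).
  by rewrite mdegE (bigD1 i) //= leq_addr.
have code_inj m m' : m \in msupp p -> m' \in msupp p -> code m = code m' -> m = m'.
  move=> mp mp'; pose ext (m : 'X_{1..n}) i := if insub i is Some j then m j else 0%N.
  have extE (x : 'X_{1..n}) (i : 'I_n) : ext x i = x i by rewrite /ext valK.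
  have small' x i : x \in msupp p -> (ext x i < K)%N.
    by rewrite /ext; case: insub => // j; apply: small.
  move=> e; apply/mnmP => i; rewrite -!extE; apply: (@sum_base_inj K n) => // [x|x|].
  - exact: small'.
  - exact: small'.
  - by move: e; rewrite /code; under eq_bigr => x _ do rewrite -extE;
    under [RHS]eq_bigr => x _ do rewrite -extE.
apply/mpolyP => m; rewrite mcoeff0; have [mp|mp] := boolP (m \in msupp p); last first.
  exact: memN_msupp_eq0.
have /(congr1 (fun Q : {poly rat} => Q`_(code m))) := P0.
rewrite coef0 coef_sum (bigD1_seq m) //= coefZ coefXn eqxx mulr1 big_seq_cond.
rewrite big1 ?addr0 // => m' /andP[mp' mm'].
rewrite coefZ coefXn; case: eqP => [/code_inj e|]; last by rewrite mulr0.
by rewrite e ?eqxx in mm'.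
Qed.

Section PositiveFractions.

Variable n : nat.
Implicit Types (x y : ratfun n) (f g : ('I_n -> rat) -> rat).

(** The numerator and denominator are positive at positive points, as for every
    subtraction-free expression; this keeps the evaluation defined under division. *)
Definition evaluates_to x f : Prop := exists p q : {mpoly rat[n]},
  [/\ forall v, pos v -> 0 < p.@[v], forall v, pos v -> 0 < q.@[v],
      x = tofrac p / tofrac q & forall v, pos v -> f v = p.@[v] / q.@[v]].

Let pos1 : pos (fun _ : 'I_n => 1). Proof. by []. Qed.

Lemma tofrac_neq0 (p : {mpoly rat[n]}) :
  (forall v, pos v -> 0 < p.@[v]) -> tofrac p != 0.
Proof.
move=> p0; rewrite tofrac_eq0; apply/eqP => e; have := p0 _ pos1.
by rewrite e meval0 ltxx.
Qed.

Lemma evaluates1 : evaluates_to 1 (fun=> 1).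
Proof.
exists 1, 1; split=> [v _|v _||v _]; rewrite ?meval1 ?tofrac1 ?divr1 //.
Qed.

Lemma evaluates_var i : evaluates_to (ratvar i) (fun v => v i).
Proof.
exists 'X_i, 1; split=> [v pv|v _||v _]; rewrite ?meval1 ?mevalXU ?tofrac1 ?divr1 //.
Qed.

Lemma evaluatesM x y f g : evaluates_to x f -> evaluates_to y g ->
  evaluates_to (x * y) (fun v => f v * g v).
Proof.
move=> [p [q [p0 q0 -> e]]] [p' [q' [p0' q0' -> e']]].
exists (p * p'), (q * q'); split=> [v pv|v pv||v pv]; rewrite ?mevalM.
- by rewrite mulr_gt0 ?p0 ?p0'.
- by rewrite mulr_gt0 ?q0 ?q0'.
- by rewrite !tofracM mulf_div.
- by rewrite e // e' // mulf_div.
Qed.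

Lemma evaluatesD x y f g : evaluates_to x f -> evaluates_to y g ->
  evaluates_to (x + y) (fun v => f v + g v).
Proof.
move=> [p [q [p0 q0 -> e]]] [p' [q' [p0' q0' -> e']]].
exists (p * q' + p' * q), (q * q').
split=> [v pv|v pv||v pv]; rewrite ?mevalD ?mevalM.
- by rewrite addr_gt0 ?mulr_gt0 ?p0 ?p0' ?q0 ?q0'.
- by rewrite mulr_gt0 ?q0 ?q0'.
- by rewrite tofracD !tofracM addf_div ?tofrac_neq0.
- by rewrite e // e' // addf_div // gt_eqF ?q0 ?q0'.
Qed.

Lemma evaluatesV x f : evaluates_to x f -> evaluates_to x^-1 (fun v => (f v)^-1).
Proof.
move=> [p [q [p0 q0 -> e]]]; exists q, p; split=> // [|v pv].
  by rewrite invf_div.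
by rewrite e // invf_div.
Qed.

Lemma evaluates_exp x f k : evaluates_to x f ->
  evaluates_to (x ^+ k) (fun v => f v ^+ k).
Proof.
move=> xf; elim: k => [|k IH]; first exact: evaluates1.
have [p [q [p0 q0 e e']]] := evaluatesM xf IH.
by exists p, q; split=> // [|v pv]; rewrite exprS; [apply: e | apply: e'].
Qed.

Lemma evaluates_prod (T : Type) (s : seq T) (X : T -> ratfun n)
    (F : T -> ('I_n -> rat) -> rat) :
  (forall i, evaluates_to (X i) (F i)) ->
  evaluates_to (\prod_(i <- s) X i) (fun v => \prod_(i <- s) F i v).
Proof.
move=> XF; elim: s => [|i s IH].
  have [p [q [p0 q0 e e']]] := evaluates1.
  by exists p, q; split=> // [|v pv]; rewrite big_nil; [apply: e | apply: e'].
have [p [q [p0 q0 e e']]] := evaluatesM (XF i) IH.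
by exists p, q; split=> // [|v pv]; rewrite big_cons; [apply: e | apply: e'].
Qed.

Lemma evaluates_path (J : finType) (ι : J -> 'I_n) w B
    (X : 'I_n -> ratfun n) (F : ('I_n -> rat) -> 'I_n -> rat) :
  (forall k, evaluates_to (X k) (F^~ k)) ->
  forall k, evaluates_to (path_var ι w B X k) (fun v => path_var ι w B (F v) k).
Proof.
elim: w B X F => //= i w IH B X F XF; apply: IH => k.
rewrite /mut_var; case: eqP => // _.
apply: evaluatesM (evaluatesV (XF k)).
by apply: evaluatesD; apply: evaluates_prod => j; apply: evaluates_exp.
Qed.

Lemma evaluates_inj x y f g : evaluates_to x f -> evaluates_to y g ->
  x = y <-> forall v, pos v -> f v = g v.
Proof.
move=> [p [q [p0 q0 -> e]]] [p' [q' [p0' q0' -> e']]].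
have tq := tofrac_neq0 q0; have tq' := tofrac_neq0 q0'.
have E v : pos v -> (f v == g v) = ((p * q' - p' * q).@[v] == 0).
  move=> pv; rewrite e // e' // eqr_div ?(lt0r_neq0 (q0 v pv)) ?(lt0r_neq0 (q0' v pv)) //.
  by rewrite mevalB !mevalM subr_eq0.
have T : (tofrac p / tofrac q == tofrac p' / tofrac q') = (p * q' - p' * q == 0).
  by rewrite (eqr_div _ _ tq tq') -!tofracM tofrac_eq subr_eq0.
split=> [/eqP|H].
  by rewrite T => /eqP pq v pv; apply/eqP; rewrite E // pq meval0.
apply/eqP; rewrite T; apply/eqP/mpoly_pos_eq0 => v pv.
by apply/eqP; rewrite -E // H.
Qed.

End PositiveFractions.

(** * Seeds and the isomorphism of cluster complexes *)

Section Seeds.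

Variables (r m : nat) (Bt : 'M[int]_(r + m, r)).

Definition path_cluster_var (w : seq 'I_r) (i : 'I_r) : ratfun (r + m) :=
  path_var (@lshift r m) w (fun k j => Bt k j) (@ratvar (r + m)) (lshift m i).

Lemma path_seed (S : preseed r m) : seed_of Bt S ->
  exists w, xvar S = path_var (@lshift r m) w (fun k j => Bt k j) (@ratvar (r + m))
    /\ (fun k j => xmat S k j) = path_mat (@lshift r m) w (fun k j => Bt k j).
Proof.
elim=> [|i {}S _ [w [ex em]]]; first by exists [::].
exists (w ++ [:: i]); rewrite path_var_cat path_mat_cat /= -ex -em; split=> //.
apply: functional_extensionality => k; apply: functional_extensionality => j.
by rewrite mxE.
Qed.

Lemma seed_path w : exists S : preseed r m, seed_of Bt S /\
  (xvar S = path_var (@lshift r m) w (fun k j => Bt k j) (@ratvar (r + m))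
    /\ (fun k j => xmat S k j) = path_mat (@lshift r m) w (fun k j => Bt k j)).
Proof.
elim/last_ind: w => [|w i [S [sS [ex em]]]].
  by exists (initial_seed Bt); split=> //; apply: seed_of_initial.
exists (mutate i S); split; first exact: seed_of_mutate.
rewrite -cats1 path_var_cat path_mat_cat /= -ex -em; split=> //.
apply: functional_extensionality => k; apply: functional_extensionality => j.
by rewrite mxE.
Qed.

Lemma cluster_path_cluster_var (S : preseed r m) : seed_of Bt S ->
  exists w, forall x, (x \in cluster S) <-> exists i, x = path_cluster_var w i.
Proof.
move=> /path_seed[w [ex _]]; exists w => x; rewrite /path_cluster_var -ex; split.
  by case/imfsetP => i _ ->; exists i.
by case=> i ->; apply/imfsetP; exists i.
Qed.

Lemma path_cluster_var_cluster w : exists S : preseed r m, seed_of Bt S /\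
  forall i, path_cluster_var w i \in cluster S.
Proof.
have [S [sS [ex _]]] := seed_path w; exists S; split=> // i.
by apply/imfsetP; exists i; rewrite // /path_cluster_var ex.
Qed.

Lemma path_cluster_var_eq w w' i j : skew_symmetric (usubmx Bt) ->
  path_cluster_var w i = path_cluster_var w' j <->
  forall v : 'I_r -> rat, pos v ->
    path_var id w (fun a b => usubmx Bt a b) v i =
    path_var id w' (fun a b => usubmx Bt a b) v j.
Proof.
move=> sB.
have sB' : principal_skew (@lshift r m) (fun k j => Bt k j).
  by move=> a b; have /matrixP/(_ b a) := sB; rewrite !mxE.
have -> : (fun a b => usubmx Bt a b) = fun a b => Bt (lshift m a) b.
  apply: functional_extensionality => a; apply: functional_extensionality => b.
  by rewrite mxE.
rewrite -(path_eq_principal (@lshift_inj r m) w w' i j sB').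
by apply: evaluates_inj; apply: evaluates_path; apply: evaluates_var.
Qed.

End Seeds.

Section Transport.

Variables (r m m' : nat) (Bt : 'M[int]_(r + m, r)) (Bt' : 'M[int]_(r + m', r)).
Hypotheses (Bt_skew : skew_symmetric (usubmx Bt)) (Bt_eq : usubmx Bt = usubmx Bt').

(** A cluster variable may be reached along many words.  One of them is chosen, and
    [transport_path_cluster_var] shows that the choice is immaterial. *)
Definition transport (x : ratfun (r + m)) : ratfun (r + m') :=
  epsilon (inhabits 0)
    (fun y => exists w i, x = path_cluster_var Bt w i /\ y = path_cluster_var Bt' w i).

Lemma transport_path_cluster_var w i :
  transport (path_cluster_var Bt w i) = path_cluster_var Bt' w i.
Proof.
rewrite /transport; have [|w' [i' [e ->]]] := epsilon_spec (inhabits 0)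
    (fun y => exists w' i',
       path_cluster_var Bt w i = path_cluster_var Bt w' i' /\ y = path_cluster_var Bt' w' i').
  by exists (path_cluster_var Bt' w i), w, i.
move/esym: e; rewrite !path_cluster_var_eq // -?Bt_eq //.
Qed.

Lemma transport_vertex x : is_cluster_var Bt x ->
  is_cluster_var Bt' (transport x) /\ exists w i, x = path_cluster_var Bt w i.
Proof.
move=> [S [/cluster_path_cluster_var[w H]]] /H[i ->]; split; last by exists w, i.
rewrite transport_path_cluster_var; have [S' [sS' cS']] := path_cluster_var_cluster Bt' w.
by exists S'.
Qed.

Lemma transport_simplex A : cluster_simplex Bt A ->
  cluster_simplex Bt' [fset transport x | x in A]%fset.
Proof.
move=> [S [/cluster_path_cluster_var[w H]]] /fsubsetP AS.
have [S' [sS' cS']] := path_cluster_var_cluster Bt' w; exists S'; split=> //.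
by apply/fsubsetP => _ /imfsetP[x /AS/H[i ->] ->]; rewrite transport_path_cluster_var.
Qed.

End Transport.

Theorem theorem4p8 (r m m' : nat) (B : 'M[int]_r)
  (Bt : 'M[int]_(r + m, r)) (Bt' : 'M[int]_(r + m', r)) :
  skew_symmetric B -> usubmx Bt = B -> usubmx Bt' = B ->
  sc_isomorphic (cluster_complex Bt) (cluster_complex Bt').
Proof.
move=> sB eB eB'; have e : usubmx Bt = usubmx Bt' by rewrite eB eB'.
have s : skew_symmetric (usubmx Bt) by rewrite eB.
have s' : skew_symmetric (usubmx Bt') by rewrite eB'.
exists (transport Bt Bt'), (transport Bt' Bt); split.
- move=> x /(transport_vertex s e)[vx [w [i xE]]]; split=> //.
  by rewrite xE !transport_path_cluster_var.
- move=> x /(transport_vertex s' (esym e))[vx [w [i xE]]]; split=> //.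
  by rewrite xE !transport_path_cluster_var.
- exact: transport_simplex.
- exact: transport_simplex.
Qed.
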